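(* Let $\alpha$ be a countable ordinal and let $\psi_\alpha$ be the $\mathcal{L}_{\omega_1,\omega}$-sentence defined in the context. The spectrum of $\psi_\alpha$ is characterized by the following properties: (1) $[\aleph_0,\aleph_\alpha^{\aleph_0}]\subseteq \mathrm{Spec}(\psi_\alpha)$ and $\aleph_{\alpha+1}\in \mathrm{Spec}(\psi_\alpha)$. (2) If there exists a $(\mu,\lambda,\kappa)$-Kurepa tree, where $\aleph_1\le\mu\le\lambda\le\aleph_{\alpha+1}$, then $[\aleph_0,\kappa]\subseteq \mathrm{Spec}(\psi_\alpha)$ (this includes $\aleph_{\alpha+1}$-Kurepa trees, when $\mu=\aleph_{\alpha+1}$). (3) No cardinal belongs to $\mathrm{Spec}(\psi_\alpha)$ except those required by (1) and (2). I.e. if $\psi_\alpha$ has a model of size $\kappa$, then $\kappa\in[\aleph_0,\max\{\aleph_\alpha^{\aleph_0},\aleph_{\alpha+1}\}]$ or there exists a $(\mu,\lambda,\kappa)$-Kurepa tree with $\mu\le\lambda\le\aleph_{\alpha+1}$.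
   Context: The sentence $\psi_\alpha$. Fix a countable ordinal $\alpha$. The vocabulary $\tau$ has constants $0$ and $c_n$ ($n\in\omega$), unary predicates $L_\beta$ ($0\le\beta\le\alpha+1$), binary relation symbols $S,V,T$ and $<_\beta$ ($1\le\beta\le\alpha+1$), and ternary relation symbols $F_\beta$ ($0\le\beta\le\alpha$) and $G$. Write $V(a)=\{x: V(a,x)\}$. Saying that $F(x,\cdot,\cdot)$ is a surjection from $A$ to $B$ means that $\{(y,z):F(x,y,z)\}$ is the graph of a surjection $A\to B$. $\psi_\alpha$ is the $\mathcal{L}_{\omega_1,\omega}(\tau)$-sentence that is the conjunction of the following requirements. (a) $L_{\alpha+1}$ is linearly ordered by $<_{\alpha+1}$ with minimum $0$; it may or may not have a maximum element. Every non-maximum $a\in L_{\alpha+1}$ has an immediate successor $b$, and $S(a,b)$ expresses that $b$ is the successor of $a$. The maximum, if it exists, is called $m$ and is not a successor. (b) For $a\in L_{\alpha+1}$, $V(a)$ is the set of nodes at level $a$; it is disjoint from every $L_\beta$, and $V(a)\cap V(b)=\emptyset$ for $a\ne b$. The universe is the union of all the $L_\beta$ and all the $V(a)$. (c) $T$ is a tree ordering on $V=\bigcup_{a\in L_{\alpha+1}}V(a)$. If $T(x,y)$, then the level of $x$ is strictly below the level of $y$. If $y\in V(a)$ and $b<_{\alpha+1}a$, there is $x\in V(b)$ with $T(x,y)$. If $a$ is a limit (neither a successor nor $0$), two distinct elements of $V(a)$ do not have the same $T$-predecessors. The tree is pruned (every node is contained in a maximal branch). If $m$ exists, the elements of $V(m)$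 play the role of maximal branches through the tree (a model need not contain all maximal branches). (d) $\forall x\,(L_0(x)\leftrightarrow\bigvee_n x=c_n)$, so $L_0$ has size $\aleph_0$. (e) Each $L_\beta$, $1\le\beta\le\alpha$, is linearly ordered by $<_\beta$ and may or may not have a maximum. For limit $\beta$, $L_\beta=\bigcup_{\gamma<\beta}L_\gamma$ (the order $<_\beta$ being unrelated to the previous orders). (f) For $\beta<\alpha$ and every $x\in L_{\beta+1}$, $F_\beta(x,\cdot,\cdot)$ is a surjection from $L_\beta$ to $\{b\in L_{\beta+1}: b\le_{\beta+1}x\}$. (g) For every $x\in L_{\alpha+1}$ that is not the maximum of $L_{\alpha+1}$, $F_\alpha(x,\cdot,\cdot)$ is a surjection from $L_\alpha$ to $\{b\in L_{\alpha+1}:b\le_{\alpha+1}x\}$ and $G(x,\cdot,\cdot)$ is a surjection from $L_\alpha$ to $V(x)$. Spectrum: $\mathrm{Spec}(\phi)=\{\kappa:\exists M\models\phi,\ |M|=\kappa\}$. Intervals are intervals of cardinals. Kurepa trees: a $\kappa$-tree has height $\kappa$ and each level has $<\kappa$ elements; a $\kappa$-Kurepa tree is a $\kappa$-tree with at least $\kappa^+$ branches of height $\kappa$ ($\kappa$-Kurepa trees are assumed pruned: every node lies on a branch of order type $\kappa$). For $\kappa\ge\lambda\ge\mu$ and $\kappa>\mu$, a $(\mu,\lambda,\kappa)$-Kurepa tree is a tree of height $\mu$, each level of which has $<\lambda$ elements, and with $\kappa$ branches of height $\mu$. *)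

(* Defs.v *)
From HB Require Import structures.
From mathcomp Require Import all_boot.
From mathcomp Require Import mathcomp_extra boolp classical_sets functions.
From mathcomp Require Import cardinality wochoice.

Set Implicit Arguments.
Unset Strict Implicit.
Unset Printing Implicit Defensive.

Local Open Scope classical_set_scope.
Local Open Scope card_scope.

(* The cardinals are represented by types: a type K stands for |K|, and every
   notion below that takes a cardinal is invariant under bijections. *)
Notation "K '<=c' L" := ([set: K%type] #<= [set: L%type])
  (at level 70, no associativity).
Notation "K '<c' L" :=
  ([set: K%type] #<= [set: L%type] /\ ~ ([set: L%type] #<= [set: K%type]))
  (at level 70, no associativity).

Definition strict T (R : rel T) (x y : T) : Prop := x <> y /\ R x y.

Definition below T (R : rel T) (x : T) : set T := [set y | strict R y x].

Definition order_iso X Y (R : rel X) (Q : rel Y) (C : set X) (D : set Y) :=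
  exists2 f : X -> Y, set_bij C D f &
    forall x y, C x -> C y -> R x y = Q (f x) (f y).

Lemma well_order_wf T (R : rel T) : well_order R -> well_founded (strict R).
Proof.
move=> wR x; apply/not_notP => nx.
have [|z [[+ zmin] _]] := wR [pred y | `[< ~ Acc (strict R) y >]].
  by exists x; apply/asboolP.
move=> /asboolP; apply; split=> y [yz Ryz]; apply/not_notP => ny.
have Rzy : R z y by apply: zmin; apply/asboolP.
have [|t [_ tuniq]] := wR [pred u | `[< u = y \/ u = z >]].
  by exists y; apply/asboolP; left.
have Rrefl u : R u u.
  have [|v [[/asboolP /= -> vmin] _]] := wR [pred v | `[< v = u >]].
    by exists u; apply/asboolP.
  by apply: vmin; apply/asboolP.
apply: yz; transitivity t; [symmetry|]; apply: tuniq; split.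
- by apply/asboolP; left.
- by move=> u /asboolP [] ->.
- by apply/asboolP; right.
- by move=> u /asboolP [] ->.
Qed.

Record countable_ordinal := CountableOrdinal {
  ord_car :> countType;
  ord_le : rel ord_car;
  ord_wo : well_order ord_le
}.

Definition ord_lt (a : countable_ordinal) : a -> a -> Prop :=
  strict (@ord_le a).

(* The ordinal a + 1: a new maximum None is added. *)
Definition succ_le T (R : rel T) : rel (option T) := fun x y =>
  match x, y with
  | _, None => true
  | None, Some _ => false
  | Some u, Some v => R u v
  end.

Lemma succ_wo T (R : rel T) : well_order R -> well_order (succ_le R).
Proof.
move=> wR A neA.
have [[u Au]|nA] := pselect (nonempty [pred u | Some u \in A]).
  have [|z [[Az zmin] zuniq]] := wR [pred u | Some u \in A]; first by exists u.
  exists (Some z); split.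
    by split=> // -[v|] Av //=; apply: zmin.
  move=> [v|] [Av vmin]; last by have := vmin _ Az.
  by congr Some; apply: zuniq; split=> // w Aw; apply: (vmin (Some w)).
have AN x : x \in A -> x = None.
  by case: x => // u Au; case: nA; exists u.
case: neA => x Ax; exists None; split.
  by split=> [|y /AN ->//]; rewrite -(AN _ Ax).
by move=> y [/AN ->].
Qed.

Definition ord_succ (a : countable_ordinal) : countable_ordinal :=
  CountableOrdinal (succ_wo (@ord_wo a)).

(* The successor cardinal |X|^+ of an infinite X: for a well-order of the
   power set of X (whose cardinal exceeds |X|), the elements having at most |X|
   predecessors form an initial segment of type |X|^+. *)
Definition succ_card (X : Type) : Type :=
  {s : set X |
    below (projT1 (well_ordering_principle (set X))) s #<= [set: X]}.

(* Transfinite recursion: aleph_b is the supremum of aleph_0 and of all the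
   (aleph_c)^+ with c < b, computed as the cardinal of their disjoint sum
   (which is not larger, since there are at most aleph_b summands). *)
Definition aleph_at (a : countable_ordinal) : a -> Type :=
  Fix (well_order_wf (@ord_wo a)) (fun=> Type)
    (fun b aleph_c =>
      (nat + {c : {c : a | ord_lt c b} &
                succ_card (aleph_c (proj1_sig c) (proj2_sig c))})%type).

Definition aleph (a : countable_ordinal) : Type :=
  (nat + {c : a & succ_card (aleph_at c)})%type.

Definition aleph1 : Type := succ_card nat.

(* The logic L_(omega_1, omega) over a vocabulary of relation symbols and
   constants. Conjunctions and disjunctions range over countable types. *)

Record vocabulary := Vocabulary {
  const_sym : Type;
  rel_sym : Type;
  arity : rel_sym -> nat
}.

Inductive term (tau : vocabulary) :=
| Var of nat
| Cst of const_sym tau.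

Inductive formula (tau : vocabulary) : Type :=
| FEq of term tau & term tau
| FRel (r : rel_sym tau) of (arity r).-tuple (term tau)
| FNot of formula tau
| FAnd of formula tau & formula tau
| FOr of formula tau & formula tau
| FImp of formula tau & formula tau
| FBigAnd (I : countType) of (I -> formula tau)
| FBigOr (I : countType) of (I -> formula tau)
| FAll of nat & formula tau
| FEx of nat & formula tau.

Arguments Var {tau}.
Arguments FBigAnd {tau} I.
Arguments FBigOr {tau} I.

Record fo_structure (tau : vocabulary) := FOStructure {
  dom :> Type;
  const_int : const_sym tau -> dom;
  rel_int : forall r : rel_sym tau, (arity r).-tuple dom -> Prop
}.

Definition upd T (e : nat -> T) (i : nat) (d : T) : nat -> T :=
  fun j => if j == i then d else e j.

Definition term_val tau (M : fo_structure tau) (e : nat -> M) (t : term tau) :=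
  match t with Var i => e i | Cst c => const_int M c end.

Fixpoint sat tau (M : fo_structure tau) (e : nat -> M) (f : formula tau) :
    Prop :=
  match f with
  | FEq s t => term_val e s = term_val e t
  | FRel r ts => rel_int (map_tuple (term_val e) ts)
  | FNot g => ~ sat e g
  | FAnd g h => sat e g /\ sat e h
  | FOr g h => sat e g \/ sat e h
  | FImp g h => sat e g -> sat e h
  | FBigAnd J g => forall j : J, sat e (g j)
  | FBigOr J g => exists j : J, sat e (g j)
  | FAll i g => forall d : M, sat (upd e i d) g
  | FEx i g => exists d : M, sat (upd e i d) g
  end.

Definition models tau (M : fo_structure tau) (f : formula tau) :=
  forall e : nat -> M, sat e f.

Definition spec tau (f : formula tau) (K : Type) : Prop :=
  exists2 M : fo_structure tau, models M f & [set: M] #= [set: K].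

Declare Scope formula_scope.
Delimit Scope formula_scope with fm.
Bind Scope formula_scope with formula.
Notation "s == t" := (FEq s t) : formula_scope.
Notation "~ f" := (FNot f) : formula_scope.
Notation "f /\ g" := (FAnd f g) : formula_scope.
Notation "f \/ g" := (FOr f g) : formula_scope.
Notation "f ~> g" := (FImp f g)
  (at level 90, g at level 200, right associativity) : formula_scope.
Notation "f <~> g" := (FAnd (FImp f g) (FImp g f))
  (at level 95, no associativity) : formula_scope.
Notation "'all_' i , f" := (FAll i f)
  (at level 200, i at level 0, f at level 200) : formula_scope.
Notation "'ex_' i , f" := (FEx i f)
  (at level 200, i at level 0, f at level 200) : formula_scope.
Notation "'And_' ( i : I ) , f" := (FBigAnd I (fun i => f%fm))
  (at level 200, i name, I at level 200, f at level 200) : formula_scope.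
Notation "'Or_' ( i : I ) , f" := (FBigOr I (fun i => f%fm))
  (at level 200, i name, I at level 200, f at level 200) : formula_scope.

Section Psi.
Variable alpha : countable_ordinal.

(* The indices 0 <= beta <= alpha + 1 are the elements of alpha + 2:
   Some (Some b) is an ordinal b < alpha, Some None is alpha and None is
   alpha + 1. *)
Definition idx : countable_ordinal := ord_succ (ord_succ alpha).

Lemma idx0_ex : exists b : idx, forall c : idx, ord_le b c.
Proof.
have [|b [[_ bmin] _]] := @ord_wo idx predT; first by exists None.
by exists b => c; apply: bmin.
Qed.

Definition idx0 : idx := projT1 (cid idx0_ex).
Definition idx_alpha : idx := Some None.
Definition idx_top : idx := None.

Definition idx_pos : countType :=
  {b : idx | `[< exists c : idx, ord_lt c b >]}.

Lemma idx_top_pos : `[< exists c : idx, ord_lt c idx_top >].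
Proof. by apply/asboolP; exists idx_alpha. Qed.

Definition pos_top : idx_pos := exist _ idx_top idx_top_pos.

Definition idx_succ (b c : idx) : Prop :=
  ord_lt b c /\ forall d : idx, ord_lt b d -> ord_le c d.

Definition idx_limit (b : idx) : Prop :=
  (exists c : idx, ord_lt c b) /\ ~ (exists c : idx, idx_succ c b).

Inductive tau_const := tau_zero | tau_c of nat.

Inductive tau_rel :=
| tau_L of idx
| tau_S | tau_V | tau_T
| tau_lt of idx_pos
| tau_F of ord_succ alpha
| tau_G.

Definition tau_arity (r : tau_rel) : nat :=
  match r with
  | tau_L _ => 1
  | tau_S | tau_V | tau_T | tau_lt _ => 2
  | tau_F _ | tau_G => 3
  end.

Definition tau : vocabulary := Vocabulary tau_const tau_arity.

Notation tm := (term tau).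
Notation fm := (formula tau).

Definition cst0 : tm := @Cst tau tau_zero.
Definition cst (n : nat) : tm := @Cst tau (tau_c n).

Definition fL (b : idx) (t : tm) : fm := @FRel tau (tau_L b) [tuple t].
Definition fS (s t : tm) : fm := @FRel tau tau_S [tuple s; t].
Definition fV (s t : tm) : fm := @FRel tau tau_V [tuple s; t].
Definition fT (s t : tm) : fm := @FRel tau tau_T [tuple s; t].
Definition flt (b : idx_pos) (s t : tm) : fm :=
  @FRel tau (tau_lt b) [tuple s; t].
Definition fle (b : idx_pos) (s t : tm) : fm := (flt b s t \/ s == t)%fm.
Definition fF (b : ord_succ alpha) (r s t : tm) : fm :=
  @FRel tau (tau_F b) [tuple r; s; t].
Definition fG (r s t : tm) : fm := @FRel tau tau_G [tuple r; s; t].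

Definition tvar (i : nat) : tm := Var i.
Local Coercion tvar : nat >-> term.

Local Notation x := 0.
Local Notation y := 1.
Local Notation z := 2.
Local Notation a := 3.
Local Notation b := 4.
Local Notation c := 5.
Local Notation u := 6.
Local Notation v := 7.
Local Notation w := 8.

(* In the following three formulas the bound variables are c, u, v, w; these
   must not be free in the arguments. *)
Definition is_max (t : tm) : fm :=
  (fL idx_top t /\ all_ c, fL idx_top c ~> fle pos_top c t)%fm.

Definition same_preds (s t : tm) : fm := (all_ u, fT u s <~> fT u t)%fm.

(* {(s, t) : R s t} is the graph of a surjection from A to B. *)
Definition surj (R : tm -> tm -> fm) (A B : tm -> fm) : fm :=
  ((all_ u, all_ v, R u v ~> A u /\ B v)
   /\ (all_ u, A u ~> ex_ v, R u v)
   /\ (all_ u, all_ v, all_ w, R u v /\ R u w ~> v == w)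
   /\ (all_ v, B v ~> ex_ u, R u v))%fm.

Definition linear_order (i : idx_pos) : fm :=
  ((all_ x, fL (val i) x ~> ~ flt i x x)
   /\ (all_ x, all_ y, all_ z, fL (val i) x /\ fL (val i) y /\ fL (val i) z ~>
        flt i x y /\ flt i y z ~> flt i x z)
   /\ (all_ x, all_ y, fL (val i) x /\ fL (val i) y ~>
        flt i x y \/ x == y \/ flt i y x))%fm.

Definition psi_a : fm :=
  (linear_order pos_top
   /\ fL idx_top cst0
   /\ (all_ a, fL idx_top a ~> fle pos_top cst0 a)
   /\ (all_ a, all_ b, fS a b <~>
        fL idx_top a /\ fL idx_top b /\ flt pos_top a b
        /\ ~ (ex_ c, fL idx_top c /\ flt pos_top a c /\ flt pos_top c b))
   /\ (all_ a, fL idx_top a /\ ~ is_max a ~> ex_ b, fS a b)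
   /\ (all_ a, is_max a ~> ~ (ex_ b, fS b a)))%fm.

Definition psi_b : fm :=
  ((all_ a, all_ x, fL idx_top a /\ fV a x ~> And_ (i : idx), ~ fL i x)
   /\ (all_ a, all_ b, fL idx_top a /\ fL idx_top b /\ ~ (a == b) ~>
        ~ (ex_ x, fV a x /\ fV b x))
   /\ (all_ x, (Or_ (i : idx), fL i x) \/ (ex_ a, fL idx_top a /\ fV a x)))%fm.

(* Well-foundedness of the predecessors of a node is not expressible in
   L_(omega_1, omega), and L_(alpha + 1) need not be well-ordered; a tree
   ordering is a strict order in which the predecessors of every node form a
   chain. For the same reason, pruned means that every node has extensions at
   all the higher levels (in particular in V(m), if m exists). The elements of
   V(m) are identified with branches, i.e. with their sets of predecessors;
   this adds something to the condition on limit levels only if m = 0. *)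
Definition psi_c : fm :=
  ((all_ x, all_ y, fT x y ~>
      ex_ a, ex_ b, fL idx_top a /\ fL idx_top b /\ fV a x /\ fV b y /\ flt pos_top a b)
   /\ (all_ x, all_ y, all_ z, fT x y /\ fT y z ~> fT x z)
   /\ (all_ x, all_ y, all_ z, fT x z /\ fT y z ~> fT x y \/ x == y \/ fT y x)
   /\ (all_ a, all_ b, all_ y, fL idx_top a /\ fL idx_top b /\ fV a y /\ flt pos_top b a ~>
        ex_ x, fV b x /\ fT x y)
   /\ (all_ a, fL idx_top a /\ ~ (a == cst0) /\ ~ (ex_ b, fS b a) ~>
        all_ x, all_ y, fV a x /\ fV a y /\ ~ (x == y) ~> ~ same_preds x y)
   /\ (all_ a, all_ b, all_ x, fL idx_top a /\ fL idx_top b /\ fV a x /\ flt pos_top a b ~>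
        ex_ y, fV b y /\ fT x y)
   /\ (all_ a, is_max a ~>
        all_ x, all_ y, fV a x /\ fV a y /\ ~ (x == y) ~> ~ same_preds x y))%fm.

(* The c_n are distinct, so that L_0 has size aleph_0. *)
Definition psi_d : fm :=
  ((all_ x, fL idx0 x <~> Or_ (n : nat), x == cst n)
   /\ (And_ (p : {p : nat * nat | (p.1 != p.2)%N}),
        ~ (cst (val p).1 == cst (val p).2)))%fm.

(* idx_top is a successor, hence the limits are the limit ordinals <= alpha. *)
Definition psi_e : fm :=
  ((And_ (i : {i : idx_pos | val i != idx_top}), linear_order (val i))
   /\ (And_ (i : {i : idx | `[< idx_limit i >]}),
        all_ x, fL (val i) x <~>
          Or_ (j : {j : idx | `[< ord_lt j (val i) >]}), fL (val j) x))%fm.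

(* Here j = i + 1. *)
Definition psi_f : fm :=
  (And_ (i : alpha),
   And_ (j : {j : idx_pos | `[< idx_succ (Some (Some i)) (val j) >]}),
     all_ x, fL (val (val j)) x ~>
       surj (fF (Some i) x) (fL (Some (Some i)))
         (fun t => fL (val (val j)) t /\ fle (val j) t x))%fm.

Definition psi_g : fm :=
  (all_ x, fL idx_top x /\ ~ is_max x ~>
     surj (fF None x) (fL idx_alpha) (fun t => fL idx_top t /\ fle pos_top t x)
     /\ surj (fG x) (fL idx_alpha) (fV x))%fm.

Definition psi : fm :=
  (psi_a /\ psi_b /\ psi_c /\ psi_d /\ psi_e /\ psi_f /\ psi_g)%fm.

End Psi.

(* Trees are given by their reflexive order. *)
Definition is_tree X (R : rel X) : Prop :=
  partial_order R /\ forall x, wo_chain R (mem (below R x)).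

Definition is_branch X (R : rel X) (B : set X) : Prop :=
  chain R (mem B) /\ forall C : set X, chain R (mem C) -> B `<=` C -> C = B.

(* Q orders mu as an initial ordinal, i.e. as the cardinal |mu|. *)
Definition initial_ordinal mu (Q : rel mu) : Prop :=
  well_order Q /\ forall i, ~ ([set: mu] #<= below Q i).

Definition tree_level X mu (R : rel X) (Q : rel mu) (i : mu) : set X :=
  [set x | order_iso R Q (below R x) (below Q i)].

Definition has_height X mu (R : rel X) (Q : rel mu) : Prop :=
  (forall x, exists i, tree_level R Q i x) /\
  (forall i, tree_level R Q i !=set0).

(* "With kappa branches" is understood as with at least kappa branches. *)
Definition kurepa_tree (mu lambda kappa : Type) X (R : rel X) : Prop :=
  [/\ mu <=c lambda, lambda <=c kappa, mu <c kappa, is_tree R &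
   exists Q : rel mu,
     [/\ initial_ordinal Q,
         has_height R Q,
         forall i, tree_level R Q i #<= [set: lambda] /\
                   ~ ([set: lambda] #<= tree_level R Q i) &
         [set: kappa] #<=
           [set B | is_branch R B /\ order_iso R Q B [set: mu]]]].

(* Main.v *)
Require Import Defs.
From mathcomp Require Import all_boot.
From mathcomp Require Import mathcomp_extra boolp classical_sets functions.
From mathcomp Require Import cardinality wochoice.
From Stdlib Require Eqdep_dec.

Set Implicit Arguments.
Unset Strict Implicit.
Unset Printing Implicit Defensive.

Local Open Scope classical_set_scope.
Local Open Scope card_scope.

(** Write A for aleph_alpha and A+ for aleph_(alpha + 1).

    Upper bounds. In a model of psi_alpha the surjections F bound |L_beta| by
    aleph_beta, because a linear order in which every point has at most X
    predecessors has size at most X+ ([card_le_of_segments], [size_L]). In the same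
    way L_(alpha + 1) without its maximum m has size at most A+, and each level
    V(a) with a <> m has at most A nodes. So everything outside V(m) has size at
    most A+ ([size_model]), and only the elements of V(m), which are determined
    by their predecessors in the tree, can be more numerous. Suppose that they
    are. The levels below m have a cofinal sequence whose length is an initial
    ordinal mu ([cofinal_seq]), and an element of V(m) is determined by its
    predecessors at the levels of this sequence ([branch_sep]). If mu is
    countable, it follows that |V(m)| <= A^aleph_0 ([branches_le_pow]).
    Otherwise the nodes at these levels form a (mu, A+, kappa)-Kurepa tree
    ([model_kurepa]).

    Models. Let K be an infinite set with |K| <= A, let I be a well-order without
    maximum whose proper initial segments have size at most |K|, and let BB be a
    nonempty set of functions on I that has at most |K| restrictions to each of
    these segments. There is a model with L_(alpha + 1) = I + 1 whose nodes at
    level i are the restrictions to the indices below i, and whose last level is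
    BB; the sets L_beta with beta <= alpha are initial segments of K in an order
    of type |K| ([spec_construction]). It has max(|K|, |I|, |BB|) elements. For I
    empty this gives all infinite cardinals up to A, for I = omega and functions
    to A those from A to A^aleph_0, for I = A+ and a single function A+, and for
    I = mu and the enumerations of the branches of a (mu, lambda, kappa)-Kurepa
    tree all cardinals from A+ to kappa ([spec_le_aleph], [spec_pow],
    [spec_aleph_succ], [spec_kurepa]).

    The cardinal arithmetic rests on two applications of Zorn's lemma: any two
    cardinals are comparable, and an infinite set is as large as its square
    ([card_le_total], [card_squareS]). *)

(** * Comparing cardinals *)

(** Injections as relations: a witness stays usable when the target type has no
    default element, and its converse is a partial surjection. *)
Lemma card_leRP T U (A : set T) (B : set U) :
  A #<= B <-> exists G : T -> U -> Prop,
    (forall x, A x -> exists2 y, B y & G x y) /\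
    (forall x x' y, A x -> A x' -> G x y -> G x' y -> x = x').
Proof.
split=> [/card_leP[f]|[G [Gtot Ginj]]].
  exists (fun x y => exists (Ax : x \in A), y = val (f (SigSub Ax))); split.
    move=> x Ax; have Ax' : x \in A by rewrite inE.
    by exists (val (f (SigSub Ax'))); [apply: set_valP | exists Ax'].
  move=> x x' y _ _ [Ax ->] [Ax' /val_inj /(inj (f := f))].
  by rewrite !inE => /(_ Logic.I Logic.I) [].
have Ax (x : A) : A (val x) by have := valP x; rewrite inE.
have /choice[h hP] : forall x : A, exists y, B y /\ G (val x) y.
  by move=> x; have [y] := Gtot _ (Ax x); exists y.
have hB (x : A) : h x \in B by rewrite inE; have [] := hP x.
apply/card_leP/injfunPex; exists (fun x => SigSub (hB x)) => // x x' _ _ [hxx'].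
apply/val_inj/(Ginj _ _ (h x)) => //; first by have [] := hP x.
by rewrite hxx'; have [] := hP x'.
Qed.

Lemma inj_le X Y (f : X -> Y) : injective f -> X <=c Y.
Proof.
move=> finj; apply/card_leRP; exists (fun x y => y = f x); split=> [x _|].
  by exists (f x).
by move=> x x' y _ _ -> /finj.
Qed.

Lemma card_le_inj X Y : X <=c Y -> Y -> exists f : X -> Y, injective f.
Proof.
move=> /card_leRP[G [Gtot Ginj]] _.
have /choice[h hP] : forall x, exists y, G x y.
  by move=> x; have [//|y _] := Gtot x; exists y.
by exists h => x x' xx'; apply: (Ginj _ _ (h x)) => //; rewrite xx'.
Qed.

(** Zorn's lemma: a maximal injective partial map from [A] to [B] is defined on
    all of [A] or reaches all of [B]. *)
Lemma card_le_total T U (A : set T) (B : set U) : A #<= B \/ B #<= A.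
Proof.
pose P := [set G : set (T * U) | [/\ G `<=` A `*` B,
  forall x x' y, G (x, y) -> G (x', y) -> x = x' &
  forall x y y', G (x, y) -> G (x, y') -> y = y']].
have [F FP Ftot|G [[GAB Gl Gr] Gmax]] := @Zorn_bigcup _ P.
  have two p q : (\bigcup_(X in F) X) p -> (\bigcup_(X in F) X) q ->
      exists X, [/\ F X, X p & X q].
    move=> [X FX Xp] [Y FY Yq]; have [XY|YX] := Ftot _ _ FX FY.
      by exists Y; split=> //; apply: XY.
    by exists X; split=> //; apply: YX.
  split=> [p [X FX Xp]|x x' y xy x'y|x y y' xy xy'].
  - by have [+ _ _] := FP _ FX; apply.
  - have [X [/FP[_ h _] Xxy Xx'y]] := two _ _ xy x'y; exact: h Xxy Xx'y.
  - have [X [/FP[_ _ h] Xxy Xx'y]] := two _ _ xy xy'; exact: h Xxy Xx'y.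
have [Gtot|] := pselect (forall x, A x -> exists y, G (x, y)).
  left; apply/card_leRP; exists (fun x y => G (x, y)); split=> [x Ax|x x' y _ _].
    by have [y Gy] := Gtot x Ax; exists y => //; have [] := GAB _ Gy.
  exact: Gl.
move=> /existsNP[x /not_implyP[Ax nGx]].
right; apply/card_leRP; exists (fun y x => G (x, y)); split; last first.
  by move=> y y' x' _ _; apply: Gr.
move=> y By; have [[x' Gx'y]|nGy] := pselect (exists x, G (x, y)).
  by exists x' => //; have [] := GAB _ Gx'y.
exfalso; apply: (Gmax (G `|` [set (x, y)])).
  by split; [left | move=> /(_ (x, y)) h; apply: nGx; exists y; apply: h; right].
split.
- by move=> p [/GAB//|->].
- move=> u u' v [Guv|/pair_equal_spec[-> ->]] [Gu'v|/pair_equal_spec[-> vy]] //.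
  + exact: Gl Guv Gu'v.
  + by case: nGy; exists u; rewrite -vy.
  + by case: nGy; exists u'.
- move=> u v v' [Guv|/pair_equal_spec[-> ->]] [Guv'|/pair_equal_spec[ux ->]] //.
  + exact: Gr Guv Guv'.
  + by case: nGx; exists v; rewrite -ux.
  + by case: nGx; exists v'.
Qed.

Lemma card_leNge T U (A : set T) (B : set U) : ~ (A #<= B) -> B #<= A.
Proof. by case: (card_le_total A B). Qed.

Lemma card_leX T U T' U' (A : set T) (B : set U) (A' : set T') (B' : set U') :
  A #<= A' -> B #<= B' -> A `*` B #<= A' `*` B'.
Proof.
move=> /card_leRP[G [Gt Gi]] /card_leRP[H [Ht Hi]]; apply/card_leRP.
exists (fun p q => G p.1 q.1 /\ H p.2 q.2); split.
  move=> [x y] [/= /Gt[x' A'x' Gx] /Ht[y' B'y' Hy]].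
  by exists (x', y').
move=> [x y] [x' y'] [u v] /= [/= Ax By] [/= Ax' By'] [/= G1 H1] [/= G2 H2].
by rewrite (Gi x x' u) // (Hi y y' v).
Qed.

Lemma card_image_leR T U (A : set T) (B : set U) (R : T -> U -> Prop) :
  (forall y, B y -> exists2 x, A x & R x y) ->
  (forall x y y', A x -> B y -> B y' -> R x y -> R x y' -> y = y') ->
  B #<= A.
Proof.
move=> Rs Rf; apply/card_leRP; exists (fun y x => A x /\ R x y); split.
  by move=> y /Rs[x Ax Rxy]; exists x.
by move=> y y' x By By' [Ax Rxy] [_ Rxy']; apply: Rf Rxy Rxy'.
Qed.

(** Indices and members are encoded separately: a point of the union is found
    from the code of one index and the code of the point in that member. *)
Lemma card_le_bigcupX I T U V (D : set I) (F : I -> set T) (A : set U)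
    (B : set V) :
  D #<= A -> (forall i, D i -> F i #<= B) -> \bigcup_(i in D) F i #<= A `*` B.
Proof.
move=> /card_leRP[G [Gt Gi]] FB.
have /choice[H Hi] : forall i, exists H : T -> V -> Prop, D i ->
    (forall x, F i x -> exists2 y, B y & H x y) /\
    (forall x x' y, F i x -> F i x' -> H x y -> H x' y -> x = x').
  move=> i; have [Di|nDi] := pselect (D i); last by exists (fun _ _ => True).
  by have /card_leRP[H HP] := FB i Di; exists H.
apply: (card_image_leR (R := fun p x => exists i, [/\ D i, F i x, G i p.1 & H i x p.2])).
  move=> x [i Di Fix]; have [u Au Giu] := Gt i Di.
  have [Ht _] := Hi i Di; have [v Bv Hxv] := Ht x Fix.
  by exists (u, v) => //; exists i.
move=> [u v] x x' _ _ _ /= [i [Di Fx Gu Hx]] [i' [Di' Fx' Gu' Hx']].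
have ii' := Gi _ _ _ Di Di' Gu Gu'; rewrite -{i' Di' Gu'}ii' in Fx' Hx'.
by have [_ h] := Hi i Di; apply: h Hx Hx'.
Qed.

Lemma card_leU_square T U (A B : set T) (C : set U) :
  A #<= C -> B #<= C -> [set: nat] #<= C -> A `|` B #<= C `*` C.
Proof.
move=> AC BC nC.
have -> : A `|` B = \bigcup_(i in [set: bool]) (if i then A else B).
  apply/seteqP; split=> [x [Ax|Bx]|x [[]//]]; first by exists true.
  - by exists false.
  - by left.
  - by right.
apply: card_le_bigcupX => [|[]//]; apply: card_le_trans nC.
by apply: (inj_le (f := nat_of_bool)) => -[] [].
Qed.

Section Square.
Variables (X : Type) (X0 : set X).
Hypothesis X0inf : [set: nat] #<= X0.

Let dm (G : set ((X * X) * X)) : set X := [set x | exists z, G ((x, x), z)].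
Let Q (G : set ((X * X) * X)) := [/\
  forall x y z, G ((x, y), z) -> [/\ dm G x, dm G y & dm G z],
  forall x y, dm G x -> dm G y -> exists z, G ((x, y), z),
  forall p q z, G (p, z) -> G (q, z) -> p = q,
  [set: nat] #<= dm G & dm G `<=` X0].

Let dmQ G : Q G -> dm G `*` dm G #<= dm G.
Proof.
move=> [G1 G2 G3 _ _]; apply/card_leRP; exists (fun p z => G (p, z)); split.
  move=> [x y] [/= dx dy]; have [z Gz] := G2 x y dx dy; exists z => //.
  by have [] := G1 _ _ _ Gz.
by move=> p q z _ _; apply: G3.
Qed.

Let Q0 : exists G, Q G.
Proof.
have /card_leRP[f [ft fi]] := X0inf.
have /card_leRP[g [gt gi]] : [set: nat * nat] #<= [set: nat].
  by have := card_nat2; rewrite card_eq_le => /andP[].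
have /choice[F FP] n : exists x, X0 x /\ f n x.
  by have [//|x X0x fx] := ft n; exists x.
have Finj : injective F.
  move=> n n' e; apply: (fi _ _ (F n)) => //; first by have [] := FP n.
  by rewrite e; have [] := FP n'.
have /choice[h hP] p : exists n, g p n by have [//|n _ gn] := gt p; exists n.
have hinj : injective h.
  by move=> p q e; apply: (gi _ _ (h p)) => //; rewrite e.
pose G := [set t | exists m n, t = ((F m, F n), F (h (m, n)))].
have GF m n : G ((F m, F n), F (h (m, n))) by exists m, n.
have dF n : dm G (F n) by exists (F (h (n, n))).
have dG x : dm G x -> exists n, x = F n by move=> [z [m [n [-> _ _]]]]; exists m.
exists G; split.
- by move=> x y z [m [n [-> -> ->]]].
- by move=> x y /dG[m ->] /dG[n ->]; exists (F (h (m, n))).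
- by move=> p q z [m [n [-> ->]]] [m' [n' [-> /Finj/hinj[-> ->]]]].
- apply/card_leRP; exists (fun n x => x = F n); split=> [n _|n n' _ _ _ ->].
    by exists (F n).
  exact: Finj.
- by move=> x /dG[n ->]; have [] := FP n.
Qed.

(** Zorn's lemma on injections of [Y * Y] into [Y], for infinite [Y] included in
    [X0]. If the domain [Y] of a maximal one had a complement in [X0] of size at
    least |Y|, then a copy [B] of [Y] could be taken there and the new pairs from
    the union of [Y] and [B], which are only |Y| many, sent into [B]. So the complement is
    smaller, and |X0| = |Y|. *)
Lemma card_squareS : X0 `*` X0 #<= X0.
Proof.
(* The empty relation is admitted as the union of the empty chain. *)
pose P := [set G | G = set0 \/ Q G].
have [F FP Ftot|G [PG Gmax]] := @Zorn_bigcup _ P.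
  have [[G0 [FG0 QG0]]|noQ] := pselect (exists G, F G /\ Q G); last first.
    left; apply/seteqP; split=> // p [G FG Gp].
    have [G0|QG] := FP _ FG; first by rewrite G0 in Gp.
    by case: noQ; exists G.
  right.
  have FQ H p : F H -> H p -> Q H by move=> /FP[->|].
  have two p q : (\bigcup_(H in F) H) p -> (\bigcup_(H in F) H) q ->
      exists H, [/\ F H, Q H, H p & H q].
    move=> [H FH Hp] [K FK Kq]; have [HK|KH] := Ftot _ _ FH FK.
      by exists K; split=> //; [apply: FQ Kq | apply: HK].
    by exists H; split=> //; [apply: FQ Hp | apply: KH].
  have dmS H x : F H -> dm H x -> dm (\bigcup_(H in F) H) x.
    by move=> FH [z Hz]; exists z, H.
  split.
  - move=> x y z [H FH Hp]; have [h _ _ _ _] := FQ _ _ FH Hp.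
    by have [dx dy dz] := h _ _ _ Hp; split; apply: dmS; eassumption.
  - move=> x y [x' ux] [y' uy]; have [H [FH [_ h _ _ _] Hx Hy]] := two _ _ ux uy.
    have [|| z Hz] := h x y; [by exists x' | by exists y' |].
    by exists z, H.
  - move=> p q z up uq; have [H [_ [_ _ h _ _] Hp Hq]] := two _ _ up uq.
    exact: h Hp Hq.
  - have [_ _ _ h _] := QG0; apply: (card_le_trans h).
    by apply: subset_card_le => x; apply: dmS.
  - move=> x [z [H FH Hz]]; have [_ _ _ _ h] := FQ _ _ FH Hz; by apply: h; exists z.
have QG : Q G.
  case: PG => // G0; have [H QH] := Q0; case: (Gmax H); last by right.
  rewrite G0; split=> // H0; have [_ _ _ + _] := QH.
  have -> : dm H = set0 by apply/seteqP; split=> // x [z /H0].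
  move=> /card_leRP[g [/(_ 0)[]//]].
have [G1 G2 G3 G4 G5] := QG; set A := dm G.
have AA : A `*` A #<= A := dmQ QG.
have AUA (B C : set X) : B #<= A -> C #<= A -> B `|` C #<= A.
  by move=> BA CA; apply: card_le_trans AA; apply: card_leU_square.
have [XA|/card_leRP[e [et ei]]] := card_le_total (X0 `\` A) A.
  have X0A : X0 #<= A.
    have -> : X0 = A `|` (X0 `\` A).
      by apply/seteqP; split=> [x|x [/G5|[]]//]; have [] := pselect (A x); [left|right].
    exact: AUA.
  apply: (card_le_trans (card_leX X0A X0A)); apply: (card_le_trans AA).
  exact: subset_card_le.
have /choice[h hP] : forall x, exists y, A x -> (X0 `\` A) y /\ e x y.
  move=> x; have [/et[y Xy exy]|nAx] := pselect (A x); last by exists x.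
  by exists y.
pose B := h @` A; pose C := A `|` B.
have BX0 y : B y -> X0 y /\ ~ A y by move=> [x Ax <-]; have [[]] := hP x Ax.
have AB : A #<= B.
  apply/card_leRP; exists (fun x y => y = h x); split=> [x Ax|x x' _ Ax Ax' ->].
    by exists (h x) => //; exists x.
  move=> hxx'; apply: (ei _ _ (h x)) => //; first by have [] := hP x Ax.
  by rewrite hxx'; have [] := hP x' Ax'.
have /card_leRP[g [gt gi]] : C `*` C #<= B.
  apply: card_le_trans AB; apply: card_le_trans AA.
  by apply: card_leX; apply: AUA => //; exact: card_image_le.
pose N := [set t : (X * X) * X | [/\ (C `*` C) t.1, ~ (A `*` A) t.1, B t.2 & g t.1 t.2]].
have dmN x : dm (G `|` N) x <-> C x.
  split=> [[z [Gz|[[]]//]]|[[z Gz]|Bx]]; first by left; exists z.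
    by exists z; left.
  have Cx : C x by right.
  have [//|z Bz gz] := gt (x, x).
  by exists z; right; split=> //; have [_ nAx] := BX0 _ Bx; case.
exfalso; apply: (Gmax (G `|` N)).
  split=> [|GN]; first by left.
  have [x [z Gz]] : A !=set0.
    by have /card_leRP[k [/(_ 0)[] // x]] := G4; exists x.
  have Ax : A x by exists z.
  have Bhx : B (h x) by exists x.
  have [_ nA] := BX0 _ Bhx; apply: nA.
  have [t Gt] : dm (G `|` N) (h x) by apply/dmN; right.
  by exists t; apply: GN.
right; split.
- move=> x y z [/G1[dx dy dz]|[[/= Cx Cy] _ Bz _]].
    by split; apply/dmN; left.
  by split; apply/dmN => //; right.
- move=> x y /dmN Cx /dmN Cy; have [[Ax Ay]|nA] := pselect ((A `*` A) (x, y)).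
    by have [z Gz] := G2 x y Ax Ay; exists z; left.
  by have [//|z Bz gz] := gt (x, y); exists z; right.
- move=> [x y] [x' y'] z [Gp|[Cp nAp Bp gp]] [Gq|[Cq nAq Bq gq]].
  + exact: G3 Gp Gq.
  + by have [_ _ Az] := G1 _ _ _ Gp; have [] := BX0 _ Bq.
  + by have [_ _ Az] := G1 _ _ _ Gq; have [] := BX0 _ Bp.
  + exact: gi gp gq.
- apply: (card_le_trans G4); apply: subset_card_le => x Ax.
  by apply/dmN; left.
- by move=> x /dmN[/G5|/BX0[]].
Qed.

End Square.

Lemma card_bigcup_le I T U (D : set I) (F : I -> set T) (A : set U) :
  [set: nat] #<= A -> D #<= A -> (forall i, D i -> F i #<= A) ->
  \bigcup_(i in D) F i #<= A.
Proof.
move=> Ainf DA FA; apply: card_le_trans (card_squareS Ainf).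
exact: card_le_bigcupX.
Qed.

Lemma card_setU_le T U (A B : set T) (C : set U) :
  [set: nat] #<= C -> A #<= C -> B #<= C -> A `|` B #<= C.
Proof.
by move=> Cinf AC BC; apply: card_le_trans (card_squareS Cinf); apply: card_leU_square.
Qed.

Lemma card_set1_le T U (x : T) (A : set U) : A !=set0 -> [set x] #<= A.
Proof.
move=> [a Aa]; apply/card_leRP; exists (fun _ => eq a); split.
  by move=> y _; exists a.
by move=> y y' a' -> ->.
Qed.

Lemma infinite_nonempty T (A : set T) : [set: nat] #<= A -> A !=set0.
Proof. by move=> /card_leRP[G [/(_ 0)[//|x Ax _] _]]; exists x. Qed.

(** * Well-orders *)

Section WellOrder.
Variables (T : Type) (R : rel T).
Hypothesis wR : well_order R.

Lemma wo_min (P : T -> Prop) :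
  (exists x, P x) -> exists x, P x /\ forall y, P y -> R x y.
Proof.
move=> [x Px]; have [|z [[/asboolP Pz zmin] _]] := wR (A := [pred x | `[< P x >]]).
  by exists x; apply/asboolP.
by exists z; split=> // y Py; apply: zmin; apply/asboolP.
Qed.

Lemma wo_refl x : R x x.
Proof.
by have [|z [-> zmin]] := wo_min (P := eq^~ x); [exists x | apply: zmin].
Qed.

Lemma wo_total x y : R x y \/ R y x.
Proof.
have [|z [[->|->] zmin]] := wo_min (P := fun z => z = x \/ z = y).
- by exists x; left.
- by left; apply: zmin; right.
- by right; apply: zmin; left.
Qed.

Lemma wo_anti x y : R x y -> R y x -> x = y.
Proof.
move=> Rxy Ryx.
have [|z [_ zuniq]] := wR (A := [pred z | `[< z = x \/ z = y >]]).
  by exists x; apply/asboolP; left.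
transitivity z; [symmetry|]; apply: zuniq; split.
- by apply/asboolP; left.
- by move=> u /asboolP[] -> //; exact: wo_refl.
- by apply/asboolP; right.
- by move=> u /asboolP[] -> //; exact: wo_refl.
Qed.

Lemma wo_trans x y z : R x y -> R y z -> R x z.
Proof.
move=> Rxy Ryz.
have [|t [tP tmin]] := wo_min (P := fun t => [\/ t = x, t = y | t = z]).
  by exists x; constructor 1.
case: tP => tE; rewrite {}tE in tmin.
- by apply: tmin; constructor 3.
- by rewrite (@wo_anti x y) //; apply: tmin; constructor 1.
- by rewrite -(@wo_anti y z) //; apply: tmin; constructor 2.
Qed.

Lemma wo_ltNge x y : strict R x y <-> ~ R y x.
Proof.
split=> [[xy Rxy] Ryx|nRyx]; first by apply: xy; exact: wo_anti.
split=> [xy|]; first by apply: nRyx; rewrite xy; exact: wo_refl.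
by have [] := wo_total x y.
Qed.

Lemma wo_leNgt x y : R x y <-> ~ strict R y x.
Proof.
split=> [Rxy /wo_ltNge//|h]; apply: contrapT => nRxy; apply: h.
exact/wo_ltNge.
Qed.

Lemma wo_lt_trans x y z : strict R x y -> strict R y z -> strict R x z.
Proof.
move=> /wo_ltNge nyx [_ yz]; apply/wo_ltNge => zx; apply: nyx.
exact: wo_trans yz zx.
Qed.

Lemma wo_le_lteq x y : R x y <-> x = y \/ strict R x y.
Proof.
split=> [Rxy|[->|[]//]]; last exact: wo_refl.
by have [->|nxy] := pselect (x = y); [left | right].
Qed.

Lemma wo_trichotomy x y : [\/ strict R x y, x = y | strict R y x].
Proof.
have [/wo_le_lteq[->|xy]|nxy] := pselect (R x y).
- by constructor 2.
- by constructor 1.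
- by constructor 3; apply/wo_ltNge.
Qed.

Lemma wo_ind (P : T -> Prop) :
  (forall x, (forall y, strict R y x -> P y) -> P x) -> forall x, P x.
Proof. by move=> IH x; elim/(well_founded_ind (well_order_wf wR)): x. Qed.

Lemma initial_segment (S : set T) :
  (forall x y, strict R y x -> S x -> S y) ->
  S = setT \/ exists2 z, ~ S z & S = below R z.
Proof.
move=> Sdown; have [ST|/existsNP nS] := pselect (forall x, S x).
  by left; apply/seteqP; split=> // x _; apply: ST.
right; have [z [nSz zmin]] := wo_min nS; exists z => //.
apply/seteqP; split=> x.
  move=> Sx; apply/wo_ltNge => zx; apply: nSz.
  have [->//|zx'] := pselect (z = x); exact: Sdown (conj zx' zx) Sx.
by move=> /wo_ltNge nzx; apply: contrapT => /zmin.
Qed.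

End WellOrder.

Lemma well_order_of_minima T (R : rel T) : antisymmetric R ->
  (forall P : T -> Prop, (exists x, P x) -> exists x, P x /\ forall y, P y -> R x y) ->
  well_order R.
Proof.
move=> anti Rmin; apply: antisymmetric_well_order => // A [x Ax].
by have [|y [Ay ymin]] := Rmin (fun x => x \in A); [exists x | exists y].
Qed.

Lemma wo_preimage T U (f : T -> U) (R : rel U) :
  injective f -> well_order R -> well_order (fun x y => R (f x) (f y)).
Proof.
move=> finj wR; apply: well_order_of_minima.
  by move=> x y /andP[xy yx]; apply: finj; apply: (wo_anti wR).
move=> P [x Px]; have [|_ [[y Py <-] ymin]] := wo_min wR (P := [set f x | x in P]).
  by exists (f x), x.
by exists y; split=> // z Pz; apply: ymin; exists z.
Qed.

Lemma exists_well_order T : exists R : rel T, well_order R.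
Proof. by have [R wR] := well_ordering_principle {classic T}; exists R. Qed.

(** If [T] embeds below some point of a well-order, take the least such point
    and pull the order back along the embedding. *)
Lemma exists_initial_ordinal T : exists Q : rel T, initial_ordinal Q.
Proof.
have [R wR] := exists_well_order T.
have [/(wo_min wR)[i [Ti imin]]|noi] :=
    pselect (exists i, [set: T] #<= below R i); last first.
  by exists R; split=> // i Ti; apply: noi; exists i.
have /card_leRP[G [Gt Gi]] := Ti.
have /choice[f fP] x : exists y, below R i y /\ G x y.
  by have [//|y yi Gxy] := Gt x; exists y.
have finj : injective f.
  move=> x x' xx'; apply: (Gi _ _ (f x)) => //; first by have [] := fP x.
  by rewrite xx'; have [] := fP x'.
exists (fun x y => R (f x) (f y)); split; first exact: wo_preimage.
move=> x Tx; have [/(wo_ltNge wR) + _] := fP x; apply; apply: imin.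
apply: (card_le_trans Tx); apply/card_leRP; exists (fun y z => z = f y); split.
  move=> y [yx Ryx]; exists (f y) => //; split=> // /finj; exact: yx.
by move=> y y' z _ _ -> /finj.
Qed.

(** If [L] were larger than [S], a copy of [S] in [L] could not be bounded by any
    [x], since the segment of [x] is too small; so [L] is the union of the |S|
    many segments of its points, each of size at most |S|. *)
Lemma card_le_of_segments T U (L : set T) (lt : T -> T -> Prop) (S : set U) :
  [set: nat] #<= S ->
  (forall x y, L x -> L y -> [\/ lt x y, x = y | lt y x]) ->
  (forall x, L x -> ~ (S #<= [set y | L y /\ (y = x \/ lt y x)])) ->
  L #<= S.
Proof.
move=> Sinf Ltot Lseg; have [//|SL] := card_le_total L S.
have /card_leRP[g [gt gi]] := SL.
have /choice[h hP] : forall s, exists y, S s -> L y /\ g s y.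
  move=> s; have [/gt[y Ly gsy]|nSs] := pselect (S s); first by exists y.
  by have [s0 /gt[y _ _]] := infinite_nonempty Sinf; exists y.
have -> : L = \bigcup_(s in S) [set x | L x /\ (x = h s \/ lt x (h s))].
  apply/seteqP; split=> [x Lx|x [y _ []//]].
  apply: contrapT => nx; apply: (Lseg x Lx).
  apply/card_leRP; exists g; split=> [s Ss|]; last exact: gi.
  have [Lh gsh] := hP s Ss; exists (h s) => //; split=> //.
  have [xh|xh|] := Ltot x (h s) Lx Lh; last by right.
    by exfalso; apply: nx; exists s => //; split=> //; right.
  by left.
apply: card_bigcup_le => // s /hP[Lh _]; apply: card_leNge; exact: Lseg.
Qed.

Lemma card_below_le T (R : rel T) (U : Type) (A : set U) x :
  [set: nat] #<= A -> below R x #<= A -> [set y | y = x \/ strict R y x] #<= A.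
Proof.
move=> Ainf xA; apply: (card_setU_le Ainf (A := [set x])) => //.
exact: card_set1_le (infinite_nonempty Ainf).
Qed.

(** * Successor cardinals *)

Section SuccCard.
Variable X : Type.
Let W : rel (set X) := projT1 (well_ordering_principle (set X)).
Let wW : well_order W := projT2 (well_ordering_principle (set X)).

(** The points with at most |X| predecessors form an initial segment of the
    well-order on [set X]. It is not everything, by Cantor's diagonal argument;
    so it is the segment of a point, which would belong to it if its size were
    at most |X|. *)
Lemma not_succ_card_le : ~ (succ_card X <=c X).
Proof.
move=> sX; have [|ST|[z nz Sz]] :=
    @initial_segment _ W wW [set s | below W s #<= [set: X]].
- move=> x y yx /=; apply: card_le_trans; apply: subset_card_le => u uy.
  exact: (wo_lt_trans wW uy yx).
- suff /card_leRP[G [Gt Gi]] : [set: set X] #<= [set: X].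
    (* Cantor's diagonal set for the injection G of [set X] into X. *)
    pose D : set X := [set x | exists s : set X, G s x /\ ~ s x].
    have [//|x _ GDx] := Gt D.
    have nDx : ~ D x.
      move=> [s [Gsx nsx]]; apply: (nsx).
      by rewrite -(Gi D s x Logic.I Logic.I GDx Gsx); exists s.
    by apply: (nDx); exists D.
  rewrite -ST; apply: card_le_trans sX.
  apply/card_leRP; exists (fun s t => s = sval t); split=> [s Ss|s s' t _ _ -> //].
  by exists (exist _ s Ss).
- apply: nz => /=; rewrite -Sz; apply: card_le_trans sX.
  apply/card_leRP; exists (fun s t => s = sval t); split=> [s Ss|s s' t _ _ -> //].
  by exists (exist _ s Ss).
Qed.

Lemma le_succ_card : X <=c succ_card X.
Proof. exact: card_leNge not_succ_card_le. Qed.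

Hypothesis Xinf : nat <=c X.

Lemma succ_card_inf : nat <=c succ_card X.
Proof. exact: card_le_trans Xinf le_succ_card. Qed.

(** A copy of [A] in [succ_card X] that is bounded lies in a segment, of size at
    most |X|. One that is unbounded makes [succ_card X] a union of |A| segments,
    hence of size at most |A| if |X| <= |A|. *)
Lemma lt_succ_card T (A : set T) :
  ~ ([set: succ_card X] #<= A) -> A #<= [set: X].
Proof.
move=> nSA; have /card_leRP[G [Gt Gi]] := card_leNge nSA.
have [[s sP]|nos] := pselect (exists s : succ_card X, forall a, A a ->
    exists2 t, strict W (sval t) (sval s) & G a t).
  apply: card_le_trans (svalP s); apply/card_leRP.
  exists (fun a u => exists2 t, u = sval t & G a t); split.
    by move=> a /sP[t ts Gat]; exists (sval t) => //; exists t.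
  move=> a a' u Aa Aa' [t -> Gat] [t' /(@eq_sig_hprop _ _ _ _ _) e].
  by rewrite -e; [exact: Gi|move=> x p q; exact: Prop_irrelevance].
have [//|XA] := card_le_total A [set: X].
have Ainf := card_le_trans Xinf XA.
exfalso; apply: nSA.
have /choice[h hP] : forall a, exists t, A a -> G a t.
  move=> a; have [/Gt[t _ Gat]|nAa] := pselect (A a); first by exists t.
  by have [t _] := infinite_nonempty succ_card_inf; exists t.
have -> : [set: succ_card X] = \bigcup_(a in A) [set s | W (sval s) (sval (h a))].
  apply/seteqP; split=> // s _; apply: contrapT => ns; apply: nos; exists s => a Aa.
  exists (h a); last exact: hP.
  by apply/(wo_ltNge wW) => sh; apply: ns; exists a.
apply: card_bigcup_le => // a Aa; apply: card_le_trans XA.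
apply: card_le_trans (card_below_le Xinf (svalP (h a))).
apply/card_leRP; exists (fun s u => u = sval s); split.
  by move=> s /(wo_le_lteq wW) sh; exists (sval s).
move=> s s' u _ _ ->; apply: eq_sig_hprop => x p q; exact: Prop_irrelevance.
Qed.

End SuccCard.

Lemma succ_card_mono X Y : nat <=c X -> X <=c Y -> succ_card X <=c succ_card Y.
Proof.
move=> Xinf XY; apply: contrapT => /(lt_succ_card Xinf) YX.
exact: not_succ_card_le (card_le_trans YX XY).
Qed.

(** * Alephs *)

Lemma inj_le_set X T (A : set T) (f : X -> T) :
  injective f -> (forall x, A (f x)) -> [set: X] #<= A.
Proof.
move=> finj fA; apply/card_leRP; exists (fun x y => y = f x); split=> [x _|].
  by exists (f x).
by move=> x x' y _ _ -> /finj.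
Qed.

(** Alephs are defined by sums of this form. *)
Lemma sum_leP (J : Type) (F : J -> Type) T (A : set T) :
  [set: nat] #<= A -> J <=c nat ->
  [set: nat + {j : J & F j}] #<= A <-> forall j, [set: F j] #<= A.
Proof.
move=> Ainf Jnat; split=> [sA j|FA].
  apply: card_le_trans sA; apply: (inj_le (f := fun x => inr (existT F j x))).
  move=> x y []; apply: Eqdep_dec.inj_pair2_eq_dec => u v; exact: pselect.
have -> : [set: nat + {j : J & F j}] =
    range inl `|` \bigcup_(j in [set: J]) range (fun x => inr (existT F j x)).
  apply/seteqP; split=> // -[n|[j x]] _; first by left; exists n.
  by right; exists j => //; exists x.
apply: card_setU_le => //; first exact: card_le_trans (card_image_le _ _) Ainf.
apply: card_bigcup_le => //; first exact: card_le_trans Jnat Ainf.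
by move=> j _; apply: card_le_trans (card_image_le _ _) (FA j).
Qed.

Section Aleph.
Variable a : countable_ordinal.
Implicit Types b c : a.

Lemma aleph_at_unfold b : aleph_at b =
  (nat + {c : {c : a | ord_lt c b} & succ_card (aleph_at (sval c))})%type.
Proof.
rewrite {1}/aleph_at Fix_eq // => x f g fg.
by have -> : f = g by apply: functional_extensionality_dep => y; apply: funext.
Qed.

Lemma sub_ord_countable (P : a -> Prop) : {c : a | P c} <=c nat.
Proof.
apply: (card_le_trans (B := [set: a])); last exact: countableP.
by apply: (inj_le (f := sval)) => c d; apply: eq_sig_hprop => x p q; exact: Prop_irrelevance.
Qed.

Lemma aleph_at_inf b : nat <=c aleph_at b.
Proof. by rewrite aleph_at_unfold; apply: (inj_le (f := inl)) => m n []. Qed.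

Lemma aleph_inf : nat <=c aleph a.
Proof. by apply: (inj_le (f := inl)) => m n []. Qed.

(** The universal property of the supremum; with [lt_succ_card] it gives the
    comparisons between alephs. *)
Lemma aleph_at_leP b T (A : set T) : [set: nat] #<= A ->
  [set: aleph_at b] #<= A <->
  forall c, ord_lt c b -> [set: succ_card (aleph_at c)] #<= A.
Proof.
move=> Ainf; rewrite aleph_at_unfold sum_leP //; last exact: sub_ord_countable.
split=> [h c cb|h [c cb]]; last exact: h.
exact: (h (exist _ c cb)).
Qed.

Lemma aleph_leP T (A : set T) : [set: nat] #<= A ->
  [set: aleph a] #<= A <-> forall c, [set: succ_card (@aleph_at a c)] #<= A.
Proof. by move=> Ainf; rewrite sum_leP //; exact: countableP. Qed.

Lemma succ_aleph_at_le b c : ord_lt c b -> succ_card (aleph_at c) <=c aleph_at b.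
Proof.
have := @aleph_at_leP b _ [set: aleph_at b] (aleph_at_inf b).
by rewrite card_lexx => -[/(_ isT) + _]; apply.
Qed.

Lemma aleph_at_lt b c : ord_lt c b -> ~ (aleph_at b <=c aleph_at c).
Proof.
move=> cb bc; exact: not_succ_card_le (card_le_trans (succ_aleph_at_le cb) bc).
Qed.

Lemma aleph_at_mono b c : ord_le c b -> aleph_at c <=c aleph_at b.
Proof.
move=> /(wo_le_lteq (@ord_wo a))[->//|/succ_aleph_at_le].
by apply: card_le_trans; exact: le_succ_card.
Qed.

Lemma lt_aleph_at b T (A : set T) : ~ ([set: aleph_at b] #<= A) ->
  ~ ([set: nat] #<= A) \/ exists2 c, ord_lt c b & A #<= [set: aleph_at c].
Proof.
move=> nbA; have [Ainf|] := pselect ([set: nat] #<= A); last by left.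
right; apply: contrapT => nc; apply: nbA; apply/aleph_at_leP => // c cb.
apply: contrapT => /(lt_succ_card (aleph_at_inf c)) Ac; apply: nc.
by exists c.
Qed.

End Aleph.

(** The aleph of an ordinal depends only on its predecessors, which are the same
    in [a] and in [a + 1]. *)
Lemma aleph_at_Some (a : countable_ordinal) (c : a) :
  [set: @aleph_at (ord_succ a) (Some c)] #= [set: aleph_at c].
Proof.
elim/(wo_ind (@ord_wo a)): c => c IH; rewrite card_eq_le; apply/andP; split.
  apply/aleph_at_leP => [|[d|] dc]; [exact: aleph_at_inf| |by case: dc].
  have dc' : ord_lt d c by case: dc => ne dc; split=> // e; apply: ne; rewrite e.
  apply: card_le_trans (succ_aleph_at_le dc'); apply: succ_card_mono.
    exact: aleph_at_inf.
  by have := IH d dc'; rewrite card_eq_le => /andP[].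
apply/aleph_at_leP => [|d dc]; first exact: aleph_at_inf.
have dc' : @ord_lt (ord_succ a) (Some d) (Some c) by case: dc => ne dc; split=> // -[].
apply: card_le_trans (succ_aleph_at_le dc'); apply: succ_card_mono.
  exact: aleph_at_inf.
by have := IH d dc; rewrite card_eq_le => /andP[].
Qed.

(** [None] is the ordinal [a] as an element of [a + 1]. *)
Lemma aleph_at_None (a : countable_ordinal) :
  [set: @aleph_at (ord_succ a) None] #= [set: aleph a].
Proof.
rewrite card_eq_le; apply/andP; split.
  apply/aleph_at_leP => [|[d|] dc]; [exact: aleph_inf| |by case: dc].
  have := @aleph_leP a _ [set: aleph a] (aleph_inf a).
  rewrite card_lexx => -[/(_ isT d) h _]; apply: card_le_trans h.
  apply: succ_card_mono; first exact: aleph_at_inf.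
  by have := aleph_at_Some d; rewrite card_eq_le => /andP[].
apply/aleph_leP => [|d]; first exact: aleph_at_inf.
have dc : @ord_lt (ord_succ a) (Some d) None by split.
apply: card_le_trans (succ_aleph_at_le dc); apply: succ_card_mono.
  exact: aleph_at_inf.
by have := aleph_at_Some d; rewrite card_eq_le => /andP[].
Qed.

Lemma aleph_succ (a : countable_ordinal) :
  [set: aleph (ord_succ a)] #= [set: succ_card (aleph a)].
Proof.
have /card_eqPle[NA AN] := aleph_at_None a.
apply/card_eqPle; split.
  apply/aleph_leP => [|c]; first exact: succ_card_inf (aleph_inf a).
  apply: succ_card_mono; first exact: aleph_at_inf.
  by apply: card_le_trans NA; apply: aleph_at_mono; case: c.
have := @aleph_leP (ord_succ a) _ [set: aleph (ord_succ a)] (aleph_inf _).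
rewrite card_lexx => -[/(_ isT None) h _]; apply: card_le_trans h.
exact: succ_card_mono (aleph_inf a) AN.
Qed.

(** * Surjections given by their graphs *)

Definition surj_graph T U (R : T -> U -> Prop) (A : T -> Prop) (B : U -> Prop) :
    Prop :=
  (forall u v, R u v -> A u /\ B v) /\
  (forall u, A u -> exists v, R u v) /\
  (forall u v w, R u v /\ R u w -> v = w) /\
  (forall v, B v -> exists u, R u v).

Lemma surj_graph_le T U (R : T -> U -> Prop) (A : set T) (B : set U) :
  surj_graph R A B -> B #<= A.
Proof.
move=> [RAB [_ [Rf Rs]]]; apply: (card_image_leR (R := R)) => [v /Rs[u Ruv]|].
  by exists u => //; have [] := RAB _ _ Ruv.
by move=> u v w _ _ _ Ruv Ruw; apply: (Rf u).
Qed.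

(** Invert an injection of [B] into [A] and send the remaining points of [A] to
    a fixed point of [B]. *)
Lemma exists_surj_graph T U (A : set T) (B : set U) :
  B #<= A -> B !=set0 -> exists R, surj_graph R A B.
Proof.
move=> /card_leRP[g [gt gi]] [v0 Bv0].
exists (fun u v => [/\ A u, B v &
  g v u \/ ~ (exists2 v', B v' & g v' u) /\ v = v0]).
split=> [u v [//]|]; split=> [u Au|]; last split=> [u v w []|v Bv].
- have [[v Bv gvu]|nv] := pselect (exists2 v, B v & g v u).
    by exists v; split=> //; left.
  by exists v0; split=> //; right.
- move=> [Au Bv [gvu|[nv ->]]] [_ Bw [gwu|[nw ->]]] //.
  + exact: gi gvu gwu.
  + by case: nw; exists v.
  + by case: nv; exists w.
- by have [u Au gvu] := gt v Bv; exists u; split=> //; left.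
Qed.

Lemma surj_graph_image T U T' U' (f : T -> T') (g : U -> U')
    (R : T -> U -> Prop) (A : set T) (B : set U) (A' : set T') (B' : set U') :
  injective f -> injective g ->
  (forall u, A' u <-> (f @` A) u) -> (forall v, B' v <-> (g @` B) v) ->
  surj_graph R A B ->
  surj_graph (fun u v => exists x y, [/\ u = f x, v = g y & R x y]) A' B'.
Proof.
move=> finj ginj AE BE [RAB [Rt [Rf Rs]]]; split.
  move=> _ _ [x [y [-> -> /RAB[Ax By]]]]; rewrite AE BE.
  by split; [exists x | exists y].
split=> [_ /AE[x Ax <-]|]; first by have [y Rxy] := Rt x Ax; exists (g y), x, y.
split=> [u v w [[x [y [-> -> Rxy]]] [x' [y' [/finj <- -> Rxy']]]]|].
  by rewrite (Rf x y y').
by move=> _ /BE[y By <-]; have [x Rxy] := Rs y By; exists (f x), x, y.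
Qed.

(** * The meaning of the sentence *)

Section Semantics.
Variable alpha : countable_ordinal.

Record interp (M : Type) := Interp {
  i0 : M;
  ic : nat -> M;
  iL : idx alpha -> M -> Prop;
  iS : M -> M -> Prop;
  iV : M -> M -> Prop;
  iT : M -> M -> Prop;
  ilt : idx_pos alpha -> M -> M -> Prop;
  iF : ord_succ alpha -> M -> M -> M -> Prop;
  iG : M -> M -> M -> Prop
}.

(** Matching on the list of arguments makes satisfaction in
    [interp_structure J] convertible to the conditions of [psi_holds]. *)
Definition interp_rel M (J : interp M) (r : tau_rel alpha) (s : seq M) : Prop :=
  match r, s with
  | tau_L b, [:: x] => iL J b x
  | tau_S, [:: x; y] => iS J x y
  | tau_V, [:: x; y] => iV J x y
  | tau_T, [:: x; y] => iT J x y
  | tau_lt b, [:: x; y] => ilt J b x y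
  | tau_F b, [:: x; y; z] => iF J b x y z
  | tau_G, [:: x; y; z] => iG J x y z
  | _, _ => False
  end.

Definition interp_structure M (J : interp M) : fo_structure (tau alpha) :=
  @FOStructure (tau alpha) M
    (fun c => match c with tau_zero => i0 J | tau_c n => ic J n end)
    (fun r t => interp_rel J r (tval t)).

Lemma interp_structureP (M : fo_structure (tau alpha)) :
  exists J : interp M, interp_structure J = M.
Proof.
case: M => M c R.
exists (@Interp M (c (tau_zero)) (fun n => c (tau_c n))
  (fun b x => R (tau_L b) [tuple x])
  (fun x y => R (tau_S alpha) [tuple x; y])
  (fun x y => R (tau_V alpha) [tuple x; y])
  (fun x y => R (tau_T alpha) [tuple x; y])
  (fun b x y => R (tau_lt b) [tuple x; y])
  (fun b x y z => R (tau_F b) [tuple x; y; z])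
  (fun x y z => R (tau_G alpha) [tuple x; y; z])).
congr FOStructure; first by apply: funext => -[].
apply: functional_extensionality_dep => s; apply: funext => t /=.
case: s t => [b||||b|b|] [[|x [|y [|z [|]]]] //= st]; congr (R _ _); exact: val_inj.
Qed.

Variables (M : Type) (J : interp M).

Local Notation L := (iL J).
Local Notation top := (idx_top alpha).
Local Notation ltop := (ilt J (pos_top alpha)).

Definition is_maximum (t : M) : Prop := L top t /\ forall c, L top c -> ltop c t \/ c = t.

Definition linear_on (i : idx_pos alpha) : Prop :=
  (forall x, L (val i) x -> ~ ilt J i x x) /\
  (forall x y z, L (val i) x /\ L (val i) y /\ L (val i) z ->
     ilt J i x y /\ ilt J i y z -> ilt J i x z) /\
  (forall x y, L (val i) x /\ L (val i) y -> ilt J i x y \/ x = y \/ ilt J i y x).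

(** The conjuncts of [psi alpha], read in [J]. *)
Record psi_holds : Prop := {
  psi_top_linear : linear_on (pos_top alpha);
  psi_top_zero : L top (i0 J);
  psi_zero_min : forall a, L top a -> ltop (i0 J) a \/ i0 J = a;
  psi_succE : forall a b, (iS J a b -> L top a /\ L top b /\ ltop a b /\
          ~ (exists c, L top c /\ ltop a c /\ ltop c b)) /\
        (L top a /\ L top b /\ ltop a b /\
          ~ (exists c, L top c /\ ltop a c /\ ltop c b) -> iS J a b);
  psi_succ_ex : forall a, L top a /\ ~ is_maximum a -> exists b, iS J a b;
  psi_max_limit : forall a, is_maximum a -> ~ exists b, iS J b a;
  psi_node_notin_L : forall a x, L top a /\ iV J a x -> forall i, ~ L i x;
  psi_levels_disjoint : forall a b, L top a /\ L top b /\ ~ (a = b) ->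
          ~ exists x, iV J a x /\ iV J b x;
  psi_cover : forall x, (exists i, L i x) \/ exists a, L top a /\ iV J a x;
  psi_T_levels : forall x y, iT J x y -> exists a b,
          L top a /\ L top b /\ iV J a x /\ iV J b y /\ ltop a b;
  psi_T_trans : forall x y z, iT J x y /\ iT J y z -> iT J x z;
  psi_T_chain : forall x y z, iT J x z /\ iT J y z -> iT J x y \/ x = y \/ iT J y x;
  psi_T_down : forall a b y, L top a /\ L top b /\ iV J a y /\ ltop b a ->
          exists x, iV J b x /\ iT J x y;
  psi_limit_sep : forall a, L top a /\ ~ (a = i0 J) /\ ~ (exists b, iS J b a) ->
          forall x y, iV J a x /\ iV J a y /\ ~ (x = y) ->
          ~ (forall u, (iT J u x -> iT J u y) /\ (iT J u y -> iT J u x));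
  psi_T_up : forall a b x, L top a /\ L top b /\ iV J a x /\ ltop a b ->
          exists y, iV J b y /\ iT J x y;
  psi_max_sep : forall a, is_maximum a ->
          forall x y, iV J a x /\ iV J a y /\ ~ (x = y) ->
          ~ (forall u, (iT J u x -> iT J u y) /\ (iT J u y -> iT J u x));
  psi_L0 : forall x, (L (idx0 alpha) x -> exists n, x = ic J n) /\
                  ((exists n, x = ic J n) -> L (idx0 alpha) x);
  psi_c_inj : forall p : {p : nat * nat | p.1 != p.2}, ~ (ic J (val p).1 = ic J (val p).2);
  psi_L_linear : forall i : {i : idx_pos alpha | val i != idx_top alpha}, linear_on (val i);
  psi_L_limit : forall i : {i : idx alpha | `[< idx_limit i >]}, forall x,
          (L (val i) x ->
             exists j : {j : idx alpha | `[< ord_lt j (val i) >]}, L (val j) x) /\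
          ((exists j : {j : idx alpha | `[< ord_lt j (val i) >]}, L (val j) x) ->
             L (val i) x);
  psi_F_surj : forall (i : alpha)
          (j : {j : idx_pos alpha | `[< idx_succ (Some (Some i)) (val j) >]}) x,
          L (val (val j)) x ->
          surj_graph (iF J (Some i) x) (L (Some (Some i)))
            (fun t => L (val (val j)) t /\ (ilt J (val j) t x \/ t = x));
  psi_top_surj : forall x, L top x /\ ~ is_maximum x ->
          surj_graph (iF J None x) (L (idx_alpha alpha))
            (fun t => L top t /\ (ltop t x \/ t = x)) /\
          surj_graph (iG J x) (L (idx_alpha alpha)) (iV J x)
}.

(** Every conjunct of [psi_holds] is convertible to the satisfaction of the
    corresponding subformula. *)
Lemma models_psi : models (interp_structure J) (psi alpha) <-> psi_holds.
Proof.
split=> [h|[a1 a2 a3 a4 a5 a6 b1 b2 b3 c1 c2 c3 c4 c5 c6 c7 d1 d2 e1 e2 f g] e].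
  have := h (fun=> i0 J).
  case=> -[a1 [a2 [a3 [a4 [a5 a6]]]]] [[b1 [b2 b3]]
    [[c1 [c2 [c3 [c4 [c5 [c6 c7]]]]]] [[d1 d2] [[e1 e2] [f g]]]]].
  split; assumption.
split; first by repeat (split; first assumption); assumption.
split; first by repeat (split; first assumption); assumption.
split; first by repeat (split; first assumption); assumption.
split; first by split; assumption.
split; first by split; assumption.
by split; assumption.
Qed.

End Semantics.

(** * Models from sets of functions *)

Lemma card_eq_enum X T (A : set T) : [set: X] #= A ->
  exists c : X -> T, injective c /\ forall x, A x <-> exists n, x = c n.
Proof.
move=> /card_eqP[f]; pose toT (n : X) : [set: X] := SigSub (mem_set (I : [set: X] n)).
exists (fun n => val (f (toT n))); split.
  by move=> m n /val_inj /(inj (f := f)); rewrite !inE => /(_ I I)[].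
move=> x; split=> [Ax|[n ->]]; last exact: set_valP.
have [[n nT] _ fn] : (f @` setT) (SigSub (mem_set Ax)) by apply: surj.
by exists n; rewrite (_ : toT n = exist _ n nT) ?fn //; exact: val_inj.
Qed.

Section Lower.
Variables (alpha : countable_ordinal) (K : Type) (Q : rel K).
Hypotheses (Kinf : nat <=c K) (KQ : initial_ordinal Q).
Hypothesis Kle : K <=c aleph alpha.
Implicit Types b c : idx alpha.

Let wQ : well_order Q := KQ.1.

(** The interpretation of [L_b] for [b <= alpha]: in an order of type |K| this is
    the initial segment of size aleph_b, or all of [K] if |K| is smaller. *)
Definition low b : set K := [set x | ~ ([set: aleph_at b] #<= below Q x)].

Lemma low_down b x y : strict Q y x -> low b x -> low b y.
Proof.
move=> yx Lx by_; apply: Lx; apply: (card_le_trans by_); apply: subset_card_le.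
by move=> z zy; exact: (wo_lt_trans wQ zy yx).
Qed.

Lemma low_cases b : low b = setT \/ [set: aleph_at b] #<= low b.
Proof.
have [|->|[z nLz Lz]] := @initial_segment _ Q wQ (low b); first exact: low_down.
  by left.
by right; rewrite Lz; apply: contrapT.
Qed.

Lemma aleph_at_alpha : [set: aleph_at (idx_alpha alpha)] #= [set: aleph alpha].
Proof.
apply: card_eq_trans (aleph_at_None alpha).
exact: (@aleph_at_Some (ord_succ alpha) None).
Qed.

Lemma low_alpha : low (idx_alpha alpha) = setT.
Proof.
apply/seteqP; split=> // x _ ax; apply: (KQ.2 x).
apply: (card_le_trans Kle); apply: card_le_trans ax.
by have := aleph_at_alpha; rewrite card_eq_le => /andP[].
Qed.

Lemma idx0_le b : ord_le (idx0 alpha) b.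
Proof. by rewrite /idx0; case: cid. Qed.

Lemma idx0_top : idx0 alpha <> None.
Proof. by move=> e; have := idx0_le (idx_alpha alpha); rewrite e. Qed.

Lemma aleph_at_idx0 : [set: aleph_at (idx0 alpha)] #<= [set: nat].
Proof.
apply/aleph_at_leP => // c /(wo_ltNge (@ord_wo (idx alpha))); have := idx0_le c.
by [].
Qed.

Lemma low0_fin x : low (idx0 alpha) x -> finite_set (below Q x).
Proof.
move=> Lx; apply/finite_setPn => nx; apply: Lx.
exact: card_le_trans aleph_at_idx0 nx.
Qed.

(** The points of [low 0] have finitely many predecessors, which makes [low 0]
    countable by [card_le_of_segments]. *)
Lemma low0_nat : low (idx0 alpha) #= [set: nat].
Proof.
apply/card_eqPle; split.
  apply: (card_le_of_segments (lt := strict Q)) => // [x y _ _|x Lx]; first exact: wo_trichotomy.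
  apply/finite_setPn; apply: (@sub_finite_set _ _ ([set x] `|` below Q x)).
    by move=> y [_ [->|yx]]; [left | right].
  by rewrite finite_setU; split; [exact: finite_set1 | exact: low0_fin].
have [->//|] := low_cases (idx0 alpha).
by apply: card_le_trans; exact: aleph_at_inf.
Qed.

(** A point of [low c] has fewer than aleph_c, hence at most aleph_b,
    predecessors. *)
Lemma low_succ b c x : idx_succ b c -> low c x ->
  [set y | low c y /\ (strict Q y x \/ y = x)] #<= low b.
Proof.
move=> [bc cmin] Lx; have [->|] := low_cases b; first exact: card_leT.
apply: card_le_trans.
apply: (@card_le_trans _ _ _ [set y | y = x \/ strict Q y x]).
  by apply: subset_card_le => y [_ [yx|->]]; [right | left].
apply: card_below_le; first exact: aleph_at_inf.
have [/card_leNge xn|[d dc xd]] := lt_aleph_at Lx.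
  by apply: (card_le_trans xn); exact: aleph_at_inf.
apply: (card_le_trans xd); apply: aleph_at_mono.
apply/(wo_leNgt (@ord_wo (idx alpha))) => /cmin cd.
exact: ((wo_ltNge (@ord_wo (idx alpha)) _ _).1 dc).
Qed.

(** Being smaller than a limit aleph means being at most an earlier aleph, and
    then smaller than the next one, which still precedes the limit. *)
Lemma low_limit b x : idx_limit b -> low b x <-> exists2 c, ord_lt c b & low c x.
Proof.
move=> [[c0 c0b] nsucc]; split=> [Lx|[c cb Lcx] bx]; last first.
  by apply: Lcx; apply: card_le_trans bx; apply: aleph_at_mono; case: cb.
have [nx|[c cb xc]] := lt_aleph_at Lx.
  exists c0 => // cx; apply: nx; apply: card_le_trans cx; exact: aleph_at_inf.
have [d [cd db]] : exists d, ord_lt c d /\ ord_lt d b.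
  apply: contrapT => nd; apply: nsucc; exists c; split=> // d cd.
  by apply/(wo_leNgt (@ord_wo (idx alpha))) => db; apply: nd; exists d.
exists d => // dx; exact: aleph_at_lt cd (card_le_trans dx xc).
Qed.

End Lower.

Section Construction.
Variable alpha : countable_ordinal.
Variables (K : Type) (Q : rel K).
Hypotheses (Kinf : nat <=c K) (KQ : initial_ordinal Q) (Kle : K <=c aleph alpha).
Variables (I : Type) (R : rel I).
Hypotheses (wR : well_order R) (Rnomax : forall i, exists j, strict R i j).
Hypothesis Rseg : forall i, below R i #<= [set: K].
Variables (W : Type) (BB : set (I -> option W)).

Let wQ : well_order Q := KQ.1.
Let lev := option I.
Let lt : lev -> lev -> Prop := strict (succ_le R).
Let wl : well_order (succ_le R) := succ_wo wR.

(** [Some i] stands for the level [i] of the tree and [None] for the level of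
    the branches, so that a node at level [a] is the restriction of a function
    to the indices below [a]. *)
Definition restr (a : lev) (f : I -> option W) : I -> option W :=
  fun i => if `[< strict (succ_le R) (Some i) a >] then f i else None.

Hypothesis BB0 : BB !=set0.
Hypothesis BBseg : forall i, restr (Some i) @` BB #<= [set: K].

Lemma restr_None f : restr None f = f.
Proof. by apply: funext => i; rewrite /restr; case: asboolP => // -[]; split. Qed.

Lemma restr_restr a b f : lt a b -> restr a (restr b f) = restr a f.
Proof.
move=> ab; apply: funext => i; rewrite /restr; case: asboolP => // ia.
by case: asboolP => // -[]; apply: (wo_lt_trans wl ia ab).
Qed.

Definition node :=
  {p : lev * (I -> option W) | exists2 f, BB f & p.2 = restr p.1 f}.

Definition restr_node a f (Bf : BB f) : node :=
  exist (fun p => exists2 f, BB f & p.2 = restr p.1 f) (a, restr a f)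
    (ex_intro2 _ _ f Bf erefl).

Definition nlev (n : node) : lev := (sval n).1.
Definition nfun (n : node) : I -> option W := (sval n).2.

Lemma node_eq (m n : node) : nlev m = nlev n -> nfun m = nfun n -> m = n.
Proof.
rewrite /nlev /nfun => mn1 mn2; apply: eq_sig_hprop.
  by move=> p u v; exact: Prop_irrelevance.
by case: (sval m) (sval n) mn1 mn2 => [a f] [b g] /= -> ->.
Qed.

Inductive univ := Low of K | Lev of lev | Node of node.

Lemma lev_min_ex : exists a : lev, forall b, succ_le R a b.
Proof.
have [|a [_ amin]] := wo_min wl (P := fun=> True); first by exists None.
by exists a => b; exact: amin.
Qed.

Let lev0 := projT1 (cid lev_min_ex).
Let lev0P : forall b, succ_le R lev0 b := projT2 (cid lev_min_ex).

Lemma low_enum : exists c : nat -> K,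
  injective c /\ forall x, low Q (idx0 alpha) x <-> exists n, x = c n.
Proof.
exact: card_eq_enum (card_esym (low0_nat alpha Kinf KQ)).
Qed.

Lemma idx_succ_inj (b c d : idx alpha) : idx_succ b c -> idx_succ b d -> c = d.
Proof.
move=> [bc cmin] [bd dmin]; apply: (wo_anti (@ord_wo (idx alpha))).
  exact: cmin.
exact: dmin.
Qed.

Lemma idx_limit_top : ~ idx_limit (idx_top alpha).
Proof.
by move=> [_]; apply; exists (idx_alpha alpha); split=> // -[[d|]|] // [].
Qed.

(** The functions of a surjection are chosen once for all [i] and [x]; the
    successor [j] of [i] is unique. *)
Lemma low_surj_ex : exists F : alpha -> K -> K -> K -> Prop,
  forall i (j : idx alpha) x, idx_succ (Some (Some i)) j ->
    low Q j x ->
    surj_graph (F i x) (low Q (Some (Some i) : idx alpha))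
      [set y | low Q j y /\ (strict Q y x \/ y = x)].
Proof.
have /choice[F FP] : forall p : alpha * K, exists F : K -> K -> Prop,
    forall j : idx alpha, idx_succ (Some (Some p.1)) j -> low Q j p.2 ->
    surj_graph F (low Q (Some (Some p.1) : idx alpha))
      [set y | low Q j y /\ (strict Q y p.2 \/ y = p.2)].
  move=> [i x] /=.
  have [[j [ij Lx]]|nj] :=
      pselect (exists j : idx alpha, idx_succ (Some (Some i)) j /\ low Q j x).
    have [|F FP] := exists_surj_graph (low_succ KQ ij Lx).
      by exists x; split=> //; right.
    by exists F => j' /(idx_succ_inj ij) <-.
  by exists (fun _ _ => True) => j ij Lx; case: nj; exists j.
by exists (fun i x => F (i, x)) => i j x; exact: FP (i, x) j.
Qed.

Lemma lev_surj_ex : exists F : lev -> K -> lev -> Prop,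
  forall a, a <> None -> surj_graph (F a) setT [set b | lt b a \/ b = a].
Proof.
suff /choice[F FP] : forall a : lev, exists F : K -> lev -> Prop,
    a <> None -> surj_graph F setT [set b | lt b a \/ b = a] by exists F.
case=> [i|]; last by exists (fun _ _ => True).
have [||F FP] := @exists_surj_graph _ _ [set: K] [set b | lt b (Some i) \/ b = Some i].
- apply: (@card_le_trans _ _ _ [set j | j = i \/ strict R j i]).
    apply/card_leRP; exists (fun b j => b = Some j); split.
      case=> [j|] [[ne //= ji]|e] //; exists j => //; last by left; case: e.
      by right; split=> // e; apply: ne; rewrite e.
    by move=> b b' j _ _ -> ->.
  exact: card_below_le.
- by exists (Some i); right.
- by exists F.
Qed.

Lemma node_surj_ex : exists G : lev -> K -> node -> Prop,
  forall a, a <> None -> surj_graph (G a) setT [set n | nlev n = a].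
Proof.
suff /choice[G GP] : forall a : lev, exists G : K -> node -> Prop,
    a <> None -> surj_graph G setT [set n | nlev n = a] by exists G.
case=> [i|]; last by exists (fun _ _ => True).
have [||G GP] := @exists_surj_graph _ _ [set: K] [set n | nlev n = Some i].
- apply: card_le_trans (BBseg i); apply/card_leRP.
  exists (fun n f => f = nfun n); split=> [n <-|n m f <- nm -> nmf].
    by exists (nfun n) => //; case: n => -[a f] [g Bg /= fg]; exists g.
  exact: node_eq.
- by have [f Bf] := BB0; exists (restr_node (Some i) Bf).
- by exists G.
Qed.

Let enum := projT1 (cid low_enum).

Lemma enum_inj : injective enum.
Proof. by have [] := projT2 (cid low_enum). Qed.

Lemma enumP x : low Q (idx0 alpha) x <-> exists n, x = enum n.
Proof. by have [_] := projT2 (cid low_enum); apply. Qed.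

Let F := projT1 (cid low_surj_ex).
Let FP := projT2 (cid low_surj_ex).
Let Ftop := projT1 (cid lev_surj_ex).
Let FtopP := projT2 (cid lev_surj_ex).
Let G := projT1 (cid node_surj_ex).
Let GP := projT2 (cid node_surj_ex).

(** The elements of [K] interpret the [L_b] with [b <= alpha], the points of
    [I + 1] interpret [L_(alpha + 1)], and restrictions of functions in [BB] are
    the nodes. One relation serves as all the orders [<_b] because the orders
    with [b <= alpha] live on [K]. *)
Definition model : interp alpha univ := {|
  i0 := Lev lev0;
  ic n := Low (enum n);
  iL b u := match u with
    | Low x => b <> None /\ low Q b x
    | Lev _ => b = None
    | Node _ => False end;
  iS u v := match u, v with
    | Lev a, Lev b => lt a b /\ ~ exists c, lt a c /\ lt c b
    | _, _ => False end;
  iV u v := match u, v with Lev a, Node n => nlev n = a | _, _ => False end;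
  iT u v := match u, v with
    | Node m, Node n =>
        lt (nlev m) (nlev n) /\ nfun m = restr (nlev m) (nfun n)
    | _, _ => False end;
  ilt b u v := match u, v with
    | Low x, Low y => strict Q x y
    | Lev x, Lev y => lt x y
    | _, _ => False end;
  iF b u v w := match b with
    | Some i => match u with
      | Low x => exists y z, [/\ v = Low y, w = Low z & F i x y z]
      | _ => False end
    | None => match u with
      | Lev a => exists y b, [/\ v = Low y, w = Lev b & Ftop a y b]
      | _ => False end
    end;
  iG u v w := match u with
      | Lev a => exists y n, [/\ v = Low y, w = Node n & G a y n]
      | _ => False end
|}.

Lemma model_maximum u : is_maximum model u <-> u = Lev None.
Proof.
split=> [[+ umax]|->]; last first.
  split=> // -[x []|[i|] _|n] //; by [left | right].
case: u umax => [x|[i|]|n] umax => [[]||_|] //.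
by have [] := umax (Lev None) erefl => [[]|].
Qed.

Lemma nfun_restr n : exists2 f, BB f & nfun n = restr (nlev n) f.
Proof. by case: n. Qed.

(** At a level without immediate predecessor, every index below is below some
    earlier level; so a node is the union of the nodes that precede it. *)
Lemma node_sep m n : nlev m = nlev n ->
  (forall i, lt (Some i) (nlev m) -> exists c, lt (Some i) c /\ lt c (nlev m)) ->
  (forall u, iT model u (Node m) -> iT model u (Node n)) -> m = n.
Proof.
move=> mn dense sub; apply: node_eq => //.
have [f Bf mf] := nfun_restr m; have [g Bg ng] := nfun_restr n.
rewrite mf ng -mn; apply: funext => i; rewrite /restr.
case: asboolP => // im; have [c [ic cm]] := dense i im.
have /= [] := sub (Node (restr_node c Bf)).
  by split=> //; rewrite /= mf restr_restr.
move=> _; rewrite {1}/nfun /= /nlev /= ng restr_restr; last by rewrite -mn.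
move=> /(congr1 (fun h => h i)); rewrite /restr.
by case: asboolP.
Qed.

(** The conditions are proved in the order of the fields of [psi_holds]. The cases
    that do not reduce to a contradiction are those in which each argument is of
    the kind that the symbol expects. *)
Lemma model_psi_holds : psi_holds model.
Proof.
have li := wo_ltNge wl; have tri := wo_trichotomy wl.
have irr a : ~ lt a a by case.
have irrQ x : ~ strict Q x x by case.
split.
- split; first by move=> [x []|a _|n] //; exact: irr.
  split=> [[x|a|n] [y|b|m] [z|c|k] [La [Lb Lc]] [ab bc]|] //.
  + by case: La.
  + exact: (wo_lt_trans wl ab bc).
  move=> [x|a|n] [y|b|m] [La Lb] //.
  + by case: La.
  + by case: La.
  + by case: Lb.
  + by have [|->|] := tri a b; [left | right; left | right; right].
- by [].
- move=> [x []|a _|n] //; have := lev0P a.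
  by move=> /(wo_le_lteq wl)[e|]; [right; rewrite -e | left].
- move=> [x|a|n] [y|b|m]; split=> //;
    try by case=> [La [Lb [ab nc]]]; first [case: La | case: Lb].
    move=> [ab nc]; do 3 (split=> //); move=> [[x|c|n] [Lc [ac cb]]] //.
    by apply: nc; exists c.
  move=> [_ [_ [ab nc]]]; split=> // -[c [ac cb]].
  by apply: nc; exists (Lev c).
- move=> [x|a|n] [La na] //; first by case: La.
  have [|b [ab bmin]] := wo_min wl (P := lt a).
    case: a na La => [i _ _|h _]; first by exists None.
    by case: h; apply/model_maximum.
  exists (Lev b); split=> // -[c [ac cb]].
  by have := bmin c ac; apply/li.
- move=> _ /model_maximum -> [[x|a|n]] // -[aN].
  case: a aN => [i iN|[]//]; case; have [j ij] := Rnomax i.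
  exists (Some j); split; last by split.
  by case: ij => ne ij; split=> // -[].
- by move=> [x|a|n] [y|b|m] [La Va] [i|].
- by move=> [x|a|n] [y|b|m] [La [Lb ab]] [[z|c|k] [ka kb]] //; apply: ab; rewrite -ka -kb.
- move=> [x|a|n].
  + by left; exists (idx_alpha alpha); split=> //; rewrite (low_alpha KQ Kle).
  + by left; exists (idx_top alpha).
  + by right; exists (Lev (nlev n)).
- move=> [x|a|n] [y|b|m] //= [nm _].
  by exists (Lev (nlev n)), (Lev (nlev m)).
- move=> [x|a|n] [y|b|m] [z|c|k] [] //= [nm nf] [mk mf].
  split; first exact: (wo_lt_trans wl nm mk).
  by rewrite nf mf restr_restr.
- move=> [x|a|n] [y|b|m] [z|c|k] [] //= [nk nf] [mk mf].
  have [nm|nm|mn] := tri (nlev n) (nlev m).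
  + by left; split=> //; rewrite nf mf restr_restr.
  + by right; left; rewrite (@node_eq n m) // nf mf nm.
  + by right; right; split=> //; rewrite nf mf restr_restr.
- move=> [x|a|n] [y|b|m] [z|c|k] [La [Lb [Va ab]]] //.
  have [f Bf kf] := nfun_restr k; exists (Node (restr_node b Bf)); split=> //=.
  split; first by rewrite Va.
  by rewrite kf restr_restr // Va.
- move=> [x|a|n] [La [a0 na]] //; first by case: La.
  move=> [y|b|m] [z|c|k] [ma [ka mk]] // same; apply: mk; congr Node.
  apply: node_sep => [|i|u]; [by rewrite ma ka| |by have [] := same u].
  rewrite ma => ia; apply: contrapT => nc; apply: na; exists (Lev (Some i)).
  by split=> // -[c [ic ca]]; apply: nc; exists c.
- move=> [x|a|n] [y|b|m] [z|c|k] [La [Lb [Va ab]]] //.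
  have [f Bf kf] := nfun_restr k; exists (Node (restr_node b Bf)); split=> //=.
  split; first by rewrite Va.
  by rewrite kf restr_restr // Va.
- move=> _ /model_maximum -> [x|a|n] [y|b|m] [nN [mN mn]] // same; apply: mn; congr Node.
  apply: node_sep => [|i|u]; [by rewrite nN mN| |by have [] := same u].
  rewrite nN => _; have [j ij] := Rnomax i; exists (Some j); split=> //.
  by case: ij => ne ij; split=> // -[].
- move=> [x|a|n]; split=> [|[k]] //.
  + by move=> [_ /enumP[k ->]]; exists k.
  + by move=> [->]; split; [exact: idx0_top | apply/enumP; exists k].
  + by move=> /idx0_top.
- by move=> [[m n] /= mn] [] /enum_inj e; rewrite e eqxx in mn.
- move=> [j /= jtop]; have jt : val j <> None by move=> e; rewrite e eqxx in jtop.
  split; first by move=> [x _|a|n] //=; exact: irrQ.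
  split=> [[x|a|n] [y|b|m] [z|c|k] [La [Lb Lc]] [ab bc]|] //.
    exact: (wo_lt_trans wQ ab bc).
  move=> [x|a|n] [y|b|m] [La Lb] //.
  by have [|->|] := wo_trichotomy wQ x y; [left | right; left | right; right].
- move=> [i /= /asboolP ilim].
  have iN : i <> None by move=> iN; apply: idx_limit_top; rewrite /idx_top -iN.
  have jN j : ord_lt j i -> j <> None.
    by move=> ji jN; move: ji; rewrite jN; case: (i) => [?|] [].
  move=> [x|a|n].
  + split=> [[_ /(low_limit Q x ilim)[j ji Lj]]|[[j /asboolP ji] /= [_ Lj]]].
      by exists (exist _ j (asboolT ji)); split=> //; exact: jN.
    by split=> //; apply/(low_limit Q x ilim); exists j.
  + by split=> [/iN//|[[j /asboolP ji] /= /(jN j ji)]].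
  + by split=> // -[].
- move=> i [j /= /asboolP ij].
  have jN : val j <> None.
    move=> jN; have [_ jmin] := ij.
    have : ord_lt (Some (Some i) : idx alpha) (idx_alpha alpha) by split.
    by move=> /jmin; rewrite jN.
  move=> [x [_ Lx]|a /= /jN//|//].
  apply: surj_graph_image (FP ij Lx); [by move=> u v []|by move=> u v []| |].
  + move=> [y|b|m]; split=> //=; try by move=> [? _].
      by move=> [_ Ly]; exists y.
    by move=> [z Lz [<-]].
  + move=> [y|b|m]; split=> //=; try by move=> [? _].
    * by move=> [[_ Ly] [yx|[yx]]]; exists y => //; split=> //; [left|right].
    * by move=> [z [Ly [yx|->]] [<-]]; split=> //; [left|right].
- move=> [x|a|n] [La na] //; first by case: La.
  have aN : a <> None by move=> aN; apply: na; rewrite aN; apply/model_maximum.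
  have Lalpha u : iL model (idx_alpha alpha) u <-> [set Low x | x in setT] u.
    case: u => [x|b|m]; split=> //=; try by move=> [? _].
      by move=> _; exists x.
    by move=> _; rewrite (low_alpha KQ Kle).
  split.
    apply: surj_graph_image (FtopP aN) => //; [by move=> u v []|by move=> u v []|].
    move=> [y|b|m]; split=> //=; try by move=> [? _].
    * by case=> [[]].
    * by move=> [_ [ba|[ba]]]; exists b => //; [left|right].
    * by move=> [c [ba|->] [<-]]; split=> //; [left|right].
  apply: surj_graph_image (GP aN) => //; [by move=> u v []|by move=> u v []|].
  move=> [y|b|m]; split=> //=.
  * by move=> [n' _].
  * by move=> [n' _].
  * by move=> nm; exists m.
  * by move=> [k ka [<-]].
Qed.

(** The union of [K], [I + 1] and the nodes has the size of the largest of |K|,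
    |I| and |BB|, since each level but the last has at most |K| nodes. *)
Lemma spec_construction kappa : K <=c kappa -> I <=c kappa ->
  BB #<= [set: kappa] ->
  [\/ kappa <=c K, kappa <=c I | [set: kappa] #<= BB] ->
  spec (psi alpha) kappa.
Proof.
move=> Kk Ik Bk kU; exists (interp_structure model).
  by apply/models_psi; exact: model_psi_holds.
have kinf := card_le_trans Kinf Kk.
have lk : lev <=c kappa.
  have -> : [set: lev] = [set None] `|` range Some.
    by apply/seteqP; split=> // -[i|] _; [right; exists i | left].
  apply: card_setU_le => //; last exact: card_le_trans (card_image_le _ _) Ik.
  exact: card_set1_le (infinite_nonempty kinf).
have BBn : BB #<= [set n | nlev n = None].
  apply/card_leRP; exists (fun f n => nfun n = f); split.
    move=> f Bf; exists (restr_node None Bf) => //; exact: restr_None.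
  by move=> f g n _ _ <- <-.
apply/card_eqPle; split.
- change ([set: univ] #<= [set: kappa]).
  have -> : [set: univ] = (range Low `|` range Lev) `|`
      \bigcup_(a in [set: lev]) (Node @` [set n | nlev n = a]).
    apply/seteqP; split=> // -[x|a|n] _; [by left; left; exists x| |].
      by left; right; exists a.
    by right; exists (nlev n) => //; exists n.
  apply: card_setU_le => //.
    apply: card_setU_le => //; first exact: card_le_trans (card_image_le _ _) Kk.
    exact: card_le_trans (card_image_le _ _) lk.
  apply: card_bigcup_le => // a _; apply: (card_le_trans (card_image_le _ _)).
  case: a => [i|].
    have /surj_graph_le h := GP (a := Some i) (fun e => ltac:(discriminate)).
    exact: card_le_trans h Kk.
  apply: card_le_trans Bk; apply/card_leRP; exists (fun n f => f = nfun n); split.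
    move=> n nN; exists (nfun n) => //; have [f Bf ->] := nfun_restr n.
    by rewrite nN restr_None.
  by move=> n m f nN mN ->; apply: node_eq; rewrite nN mN.
- change ([set: kappa] #<= [set: univ]); case: kU => h.
  + by apply: (card_le_trans h); apply: (inj_le (f := Low)) => x y [].
  + apply: (card_le_trans h); apply: (inj_le (f := fun i => Lev (Some i))).
    by move=> x y [].
  + apply: (card_le_trans h); apply: (card_le_trans BBn).
    apply/card_leRP; exists (fun n u => u = Node n); split=> [n _|n m u _ _ -> []//].
    by exists (Node n).
Qed.

End Construction.

(** * Cardinals in the spectrum *)

(** If the maximum of L_(alpha + 1) is its only element, no surjections onto
    levels are required; [K] then gives the model its size. *)
Lemma spec_le_aleph alpha kappa :
  nat <=c kappa -> kappa <=c aleph alpha -> spec (psi alpha) kappa.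
Proof.
move=> kinf ka; have [Q kQ] := exists_initial_ordinal kappa.
have wv : well_order (fun _ _ : void => true) by move=> A [[]].
apply: (@spec_construction alpha kappa Q kinf kQ ka void _ wv _ _ unit [set fun=> None]);
  try by case.
- by exists (fun=> None).
- exact: card_lexx.
- by apply: (inj_le (f := fun v : void => match v with end)) => -[].
- exact: card_set1_le (infinite_nonempty kinf).
- by constructor 1; exact: card_lexx.
Qed.

Lemma wo_nat : well_order leq.
Proof.
apply: well_order_of_minima; first exact: anti_leq.
move=> P [n Pn]; have [|m /asboolP Pm mmin] := @ex_minnP (fun n => `[< P n >]).
  by exists n; apply/asboolP.
by exists m; split=> // k Pk; apply: mmin; apply/asboolP.
Qed.

Lemma strict_leq m n : strict leq m n <-> (m < n)%N.
Proof.
by rewrite /strict ltn_neqAle; split=> [[/eqP -> ->]|/andP[/eqP]].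
Qed.

Lemma restr_leq W n (f : nat -> option W) i :
  restr leq (Some n) f i = if (i < n)%N then f i else None.
Proof.
rewrite /restr; congr (if _ then _ else _).
apply/asboolP/idP => [[ne im]|/strict_leq[ne im]].
  by apply/strict_leq; split=> // e; apply: ne; rewrite e.
by split=> // -[].
Qed.

Lemma nat_initial : initial_ordinal leq.
Proof.
split=> [|n]; first exact: wo_nat.
apply/finite_setPn; have -> : below leq n = `I_n.
  by apply/seteqP; split=> m /strict_leq.
exact: finite_II.
Qed.

(** A function on [n + 1] is a function on [n] and one more value. *)
Lemma restr_nat_le A n : nat <=c A ->
  range (@restr nat leq A (Some n)) #<= [set: A].
Proof.
move=> Ainf.
have [a0 _] := infinite_nonempty Ainf.
elim: n => [|n IH].
  apply: (@card_le_trans _ _ _ [set fun=> None]); last by apply: card_set1_le; exists a0.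
  by apply: subset_card_le => _ [f _ <-]; apply: funext => i; rewrite restr_leq.
have oA : option A <=c A.
  have -> : [set: option A] = [set None] `|` range Some.
    by apply/seteqP; split=> // -[i|] _; [right; exists i | left].
  apply: card_setU_le => //; last exact: card_image_le.
  by apply: card_set1_le; exists a0.
apply: card_le_trans (card_squareS Ainf).
apply: card_le_trans (card_leX IH oA).
apply/card_leRP; exists (fun g p => exists f, [/\ g = restr leq (Some n.+1) f,
  p.1 = restr leq (Some n) f & p.2 = f n]); split.
  move=> _ [f _ <-]; exists (restr leq (Some n) f, f n); last by exists f.
  by split=> //; exists f.
move=> _ _ p _ _ [f [-> -> ->]] [g [-> fg fgn]]; apply: funext => i.
move: fg => /(congr1 (fun h => h i)); rewrite !restr_leq ltnS.
by case: ltngtP => // ->.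
Qed.

(** Any set of sequences of elements of aleph_alpha can be the set of branches,
    as there are only aleph_alpha finite sequences. *)
Lemma spec_pow alpha kappa :
  aleph alpha <=c kappa -> kappa <=c (nat -> aleph alpha) ->
  spec (psi alpha) kappa.
Proof.
move=> ak kpow; set A := aleph alpha; have Ainf := aleph_inf alpha.
have [a0 _] := infinite_nonempty Ainf.
have [Q AQ] := exists_initial_ordinal A.
have [f finj] := card_le_inj kpow (fun=> a0).
pose BB := range (fun k n => Some (f k n)).
have Binj : injective (fun k n => Some (f k n)).
  move=> k l e; apply: finj; apply: funext => n.
  by have := congr1 (fun h => h n) e => -[].
have [k0 _] := infinite_nonempty (card_le_trans Ainf ak).
apply: (@spec_construction alpha A Q Ainf AQ _ nat leq wo_nat _ _ A BB) => //.
- by move=> n; exists n.+1; apply/strict_leq.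
- move=> n; apply: card_leNge => An; apply: (nat_initial.2 n).
  exact: card_le_trans Ainf An.
- by exists (fun n => Some (f k0 n)), k0.
- move=> n; apply: card_le_trans (restr_nat_le n Ainf).
  by apply: subset_card_le => _ [g _ <-]; exists g.
- exact: card_le_trans Ainf ak.
- exact: card_image_le.
- by constructor 3; apply: inj_le_set Binj _ => k; exists k.
Qed.

(** Removing a maximum would leave a segment of the same infinite size. *)
Lemma initial_nomax T (Q : rel T) : nat <=c T -> initial_ordinal Q ->
  forall i, exists j, strict Q i j.
Proof.
move=> Tinf [wQ Qi] i; apply: contrapT => nj; apply: (Qi i).
have Ti : [set: T] `<=` [set y | y = i \/ strict Q y i].
  move=> y _; have [|->|iy] := wo_trichotomy wQ y i; [by right | by left |].
  by case: nj; exists y.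
apply: (card_le_trans (subset_card_le Ti)); apply: card_below_le; last exact: card_lexx.
apply/infiniteP => fin; move: Tinf; apply/finite_setPn.
apply: (sub_finite_set Ti); apply: (@sub_finite_set _ _ ([set i] `|` below Q i)).
  by move=> y [->|]; [left | right].
by rewrite finite_setU; split.
Qed.

Lemma lt_aleph_succ alpha T (A : set T) :
  ~ ([set: aleph (ord_succ alpha)] #<= A) -> A #<= [set: aleph alpha].
Proof.
move=> nA; apply: lt_succ_card => [|sA]; first exact: aleph_inf.
apply: nA; apply: card_le_trans sA.
by have := aleph_succ alpha; rewrite card_eq_le => /andP[].
Qed.

Lemma aleph_le_succ alpha : aleph alpha <=c aleph (ord_succ alpha).
Proof.
apply: (card_le_trans (@le_succ_card _)).
by have := aleph_succ alpha; rewrite card_eq_le => /andP[].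
Qed.

(** A tree with one branch of length aleph_(alpha + 1): its levels already have
    the required size. *)
Lemma spec_aleph_succ alpha : spec (psi alpha) (aleph (ord_succ alpha)).
Proof.
set A := aleph alpha; set B := aleph (ord_succ alpha).
have Ainf := aleph_inf alpha; have Binf := aleph_inf (ord_succ alpha).
have [Q AQ] := exists_initial_ordinal A.
have [R BR] := exists_initial_ordinal B.
have [a0 _] := infinite_nonempty Ainf.
apply: (@spec_construction alpha A Q Ainf AQ _ B R BR.1 _ _ unit [set fun=> None]).
- exact: card_lexx.
- exact: initial_nomax.
- by move=> i; apply: lt_aleph_succ; exact: BR.2.
- by exists (fun=> None).
- move=> i; apply: card_le_trans (card_image_le _ _) _.
  exact: card_set1_le (infinite_nonempty Ainf).
- exact: aleph_le_succ.
- exact: card_lexx.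
- exact: card_set1_le (infinite_nonempty Binf).
- by constructor 2; exact: card_lexx.
Qed.

(** * Kurepa trees give models *)

Section Branches.
Variables (X mu : Type) (R : rel X) (Q : rel mu).
Hypotheses (tR : is_tree R) (wQ : well_order Q).

Lemma tree_chain x y z : R y x -> R z x -> R y z \/ R z y.
Proof.
have [[[Rxx _] _] Rch] := tR => yx zx.
have [->|yx'] := pselect (y = x); first by right.
have [->|zx'] := pselect (z = x); first by left.
have [||t [[/asboolP tP tmin] _]] := Rch x [pred t | `[< t = y \/ t = z >]].
- by move=> t /asboolP[->|->]; apply/mem_set; split.
- by exists y; apply/asboolP; left.
by case: tP => <-; [left | right]; apply: tmin; apply/asboolP; [right | left].
Qed.

(** In a tree, [y] is comparable with every point that is comparable with [x];
    by maximality [y] belongs to [B]. *)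
Lemma branch_down B x y : is_branch R B -> B x -> R y x -> B y.
Proof.
have [[[Rxx Rtr] _] _] := tR; move=> [Bch Bmax] Bx yx.
have Bc u v : B u -> B v -> R u v \/ R v u.
  by move=> Bu Bv; apply/orP; apply: Bch; exact: mem_set.
have yB u : B u -> R u y \/ R y u.
  move=> Bu; have [ux|xu] := Bc u x Bu Bx; first exact: tree_chain ux yx.
  by right; exact: Rtr yx xu.
rewrite -(Bmax (B `|` [set y])); [by right| |by left].
move=> u v /set_mem[Bu|->] /set_mem[Bv|->]; apply/orP.
- exact: Bc.
- exact: yB.
- by have [] := yB v Bv; [right|left].
- by left.
Qed.

(** [h] lists the branch [B] by level. *)
Definition enumerates (h : mu -> X) (B : set X) : Prop :=
  [/\ forall i, B (h i), forall x, B x -> exists i, x = h i &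
      forall i j, R (h i) (h j) = Q i j].

Lemma branch_enum B : order_iso R Q B [set: mu] -> exists h, enumerates h B.
Proof.
move=> [f [_ finj fsurj] fR].
have /choice[h hP] : forall i, exists x, B x /\ f x = i.
  by move=> i; have [//|x Bx fx] := fsurj i; exists x.
exists h; split=> [i|x Bx|i j]; first by have [] := hP i.
- exists (f x); apply: finj; rewrite ?inE //; first by have [] := hP (f x).
  by have [_ ->] := hP (f x).
- have [Bi fi] := hP i; have [Bj fj] := hP j.
  by rewrite fR // fi fj.
Qed.

Lemma enumerates_inj B h : enumerates h B -> injective h.
Proof.
move=> [_ _ hR] i j ij; apply: (wo_anti wQ); rewrite -hR ij hR; exact: wo_refl.
Qed.

Lemma branch_level B h i : is_branch R B -> enumerates h B ->
  tree_level R Q i (h i).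
Proof.
move=> Bb hB; have hinj := enumerates_inj hB; have [Bh Bsurj hR] := hB.
have belowP x : below R (h i) x -> exists j, strict Q j i /\ x = h j.
  move=> [xi Rxi]; have [j xj] := Bsurj x (branch_down Bb (Bh i) Rxi).
  exists j; split=> //; split; last by rewrite -hR -xj.
  by move=> ji; apply: xi; rewrite xj ji.
have /choice[f fP] : forall x, exists j, (exists k, x = h k) -> x = h j.
  by move=> x; have [[k ->]|nx] := pselect (exists k, x = h k); [exists k | exists i].
have fh j : f (h j) = j by apply: hinj; rewrite -(fP (h j)) //; exists j.
exists f; last first.
  by move=> x y /belowP[j [_ ->]] /belowP[k [_ ->]]; rewrite !fh hR.
split.
- by move=> x /belowP[j [ji ->]]; rewrite /= fh.
- by move=> x y; rewrite !inE => /belowP[j [_ ->]] /belowP[k [_ ->]]; rewrite !fh => ->.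
- move=> j [ji Qji]; exists (h j); last exact: fh.
  by split; [move=> /hinj|rewrite hR].
Qed.

(** Two branches through the same node coincide below it: both list its
    predecessors in increasing order. Hence a level bounds the number of
    restrictions of branches to the levels below. *)
Lemma branch_agree B C g h i : is_branch R B -> is_branch R C ->
  enumerates g B -> enumerates h C -> g i = h i ->
  forall j, strict Q j i -> g j = h j.
Proof.
have [[_ Ranti] _] := tR.
move=> Bb Cb gB hC; have ginj := enumerates_inj gB; have hinj := enumerates_inj hC.
have [Bg Bs gR] := gB; have [Ch Cs hR] := hC => gh.
elim/(wo_ind wQ) => j IH ji.
have [k gk] : exists k, h j = g k.
  by apply: Bs; apply: branch_down Bb (Bg i) _; rewrite gh hR; case: ji.
have [l hl] : exists l, g j = h l.
  by apply: Cs; apply: branch_down Cb (Ch i) _; rewrite -gh gR; case: ji.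
have jk : Q j k.
  apply/(wo_leNgt wQ) => kj; have := IH k kj (wo_lt_trans wQ kj ji).
  by rewrite -gk => /hinj jk; case: kj => kj _; apply: kj.
have jl : Q j l.
  apply/(wo_leNgt wQ) => lj; have := IH l lj (wo_lt_trans wQ lj ji).
  by rewrite -hl => /ginj jl; case: lj => lj _; apply: lj.
by apply: Ranti; apply/andP; split; [rewrite gk gR | rewrite hl hR].
Qed.

End Branches.

Lemma le_aleph_or_succ_le alpha kappa : nat <=c kappa ->
  kappa <=c aleph alpha \/ aleph (ord_succ alpha) <=c kappa.
Proof.
move=> kinf; have [|/lt_aleph_succ] := pselect (aleph (ord_succ alpha) <=c kappa).
  by right.
by left.
Qed.

(** Branches are taken as functions from levels to nodes. Their restrictions
    form a tree in which distinct nodes of a limit level have distinct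
    predecessors, a property that the given tree need not have. Cardinals up to
    aleph_alpha are covered by [spec_le_aleph]. *)
Lemma spec_kurepa alpha mu lambda kappa X (R : rel X) kappa' :
  nat <=c mu -> lambda <=c aleph (ord_succ alpha) ->
  kurepa_tree mu lambda kappa R ->
  nat <=c kappa' -> kappa' <=c kappa -> spec (psi alpha) kappa'.
Proof.
move=> muinf la [ml _ _ tR [Q [muQ [_ _] Qlev Qbr]]] k'inf k'k.
have [k'a|ak'] := le_aleph_or_succ_le alpha k'inf; first exact: spec_le_aleph.
have wQ := muQ.1; set A := aleph alpha; have Ainf := aleph_inf alpha.
have [W AW] := exists_initial_ordinal A.
have mua : mu <=c aleph (ord_succ alpha) := card_le_trans ml la.
have /card_leRP[G [Gt Gi]] := card_le_trans k'k Qbr.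
have /choice[Br BrP] : forall k, exists B,
    (is_branch R B /\ order_iso R Q B [set: mu]) /\ G k B.
  by move=> k; have [//|B PB GkB] := Gt k; exists B.
have /choice[h hP] k : exists h, enumerates R Q h (Br k).
  by apply: branch_enum; have [[]] := BrP k.
have hinj : injective (fun k i => Some (h k i)).
  move=> k l e; apply: (Gi _ _ (Br k)) => //; first by have [] := BrP k.
  have [_ Gl] := BrP l; suff -> : Br k = Br l by [].
  have hkl i : h k i = h l i by have := congr1 (fun f => f i) e => -[].
  have [hk1 hk2 _] := hP k; have [hl1 hl2 _] := hP l.
  apply/seteqP; split=> x.
    by move=> /hk2[i ->]; rewrite hkl.
  by move=> /hl2[i ->]; rewrite -hkl.
have [k0 _] := infinite_nonempty k'inf.
apply: (@spec_construction alpha A W Ainf AW _ mu Q wQ _ _ X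
  (range (fun k i => Some (h k i)))) => //.
- exact: initial_nomax.
- move=> i; apply: lt_aleph_succ => Ai; apply: (muQ.2 i).
  exact: card_le_trans mua Ai.
- by exists (fun i => Some (h k0 i)), k0.
- move=> i; apply: (@card_le_trans _ _ _ (tree_level R Q i)); last first.
    apply: lt_aleph_succ => Ai; have [_] := Qlev i; apply.
    exact: card_le_trans la Ai.
  apply/card_leRP; exists (fun r x => exists k,
    r = restr Q (Some i) (fun i => Some (h k i)) /\ x = h k i); split.
    move=> _ [_ [k _ <-] <-]; exists (h k i); last by exists k.
    by apply: (branch_level tR wQ) (hP k); have [[]] := BrP k.
  move=> _ _ x _ _ [k [-> xk]] [l [-> xl]]; apply: funext => j; rewrite /restr.
  case: asboolP => // ji; congr Some.
  apply: (branch_agree tR wQ _ _ (hP k) (hP l) (i := i)).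
  + by have [[]] := BrP k.
  + by have [[]] := BrP l.
  + by rewrite -xk.
  + by case: ji => ne ji; split=> // e; apply: ne; rewrite e.
- exact: card_le_trans (aleph_le_succ alpha) ak'.
- exact: card_le_trans mua ak'.
- exact: card_image_le.
- by constructor 3; apply: inj_le_set hinj _ => k; exists k.
Qed.

(** * Cofinal sequences *)

(** Rigidity of well-orders: the two isomorphisms from [C] agree by induction,
    so their images are the same segment. It makes the level of a node unique. *)
Lemma iso_below_le X mu (R : rel X) (Q : rel mu) (C : set X) i j :
  well_order Q -> order_iso R Q C (below Q i) -> order_iso R Q C (below Q j) ->
  Q i j.
Proof.
move=> wQ [f [ffun finj fsurj] fR] [g [gfun ginj gsurj] gR].
have fg k : forall x, C x -> f x = k -> g x = k.
  elim/(wo_ind wQ): k => k IH x Cx fx.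
  have [gk|//|kg] := wo_trichotomy wQ (g x) k.
    have [y Cy fy] : (f @` C) (g x).
      by apply: fsurj; apply: (wo_lt_trans wQ gk); rewrite -fx; exact: ffun.
    have gy := IH _ gk y Cy fy.
    have xy : x = y by apply: ginj; rewrite ?inE.
    by case: gk => gk _; case: gk; rewrite -fy -xy.
  have [y Cy gy] : (g @` C) k.
    by apply: gsurj; apply: (wo_lt_trans wQ kg); exact: gfun.
  (* The point sent to k by g comes before x, so f and g agree on it. *)
  have fyk : strict Q (f y) k.
    apply/(wo_ltNge wQ); rewrite -fx -fR // gR // gy.
    by move=> gxk; move/(wo_ltNge wQ): kg.
  have := IH _ fyk y Cy erefl; rewrite gy => kfy.
  by case: fyk => e _; case: e.
apply/(wo_leNgt wQ) => ji; have [x Cx fx] := fsurj j ji.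
by have [] := gfun x Cx; rewrite (fg j x Cx fx).
Qed.

Section Cofinal.
Variables (P : Type) (lt : P -> P -> Prop).
Hypotheses
  (lt_trans : forall x y z, lt x y -> lt y z -> lt x z)
  (lt_tri : forall x y, [\/ lt x y, x = y | lt y x]).

Let le x y := x = y \/ lt x y.

(** Well-order [P], and take the least ordinal [i] such that some map from the
    ordinals below [i] to [P] is cofinal. By minimality the values chosen before
    stage [j < i] have a strict upper bound, so a cofinal map can be made
    increasing by recursion; and [i] is an initial ordinal, since an injection of
    [i] into a smaller [j] would yield a cofinal map defined below [j]. *)
Lemma cofinal_seq : exists (mu : Type) (Q : rel mu) (g : mu -> P),
  [/\ initial_ordinal Q, forall i j, strict Q i j -> lt (g i) (g j) &
      forall x, exists i, x = g i \/ lt x (g i)].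
Proof.
have [W wW] := exists_well_order P; have wW1 := succ_wo wW.
pose cof (i : option P) := exists f : P -> P,
  forall x, exists k, strict (succ_le W) (Some k) i /\ le x (f k).
have [|i [[f fcof] imin]] := wo_min wW1 (P := cof).
  by exists None, id => x; exists x; split=> //; left.
have ncof j : strict (succ_le W) j i -> ~ cof j.
  by move=> ji /imin; apply/(wo_ltNge wW1).
pose mu := {k : P | strict (succ_le W) (Some k) i}.
have mu_eq (k l : mu) : sval k = sval l -> k = l.
  by move=> kl; apply: eq_sig_hprop => // x p q; exact: Prop_irrelevance.
pose Q : rel mu := fun k l => W (sval k) (sval l).
have wQ : well_order Q by exact: (wo_preimage (f := sval)).
have QW (k l : mu) : strict Q k l <-> strict (succ_le W) (Some (sval k)) (Some (sval l)).
  split=> -[ne kl]; split=> //; first by case=> /mu_eq.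
  by move=> e; apply: ne; rewrite e.
exists mu, Q.
(* The increasing sequence g must dominate f and exceed its earlier values. *)
pose good (j : mu) (rec : forall k, strict Q k j -> P) y :=
  le (f (sval j)) y /\ forall k p, lt (rec k p) y.
pose step (j : mu) (rec : forall k, strict Q k j -> P) : P :=
  if pselect (exists y, good j rec y) is left e then projT1 (cid e) else f (sval j).
pose g := Fix (well_order_wf wQ) (fun=> P) step.
have gE j : g j = step j (fun k _ => g k).
  rewrite /g Fix_eq // => x u v uv; congr (step x).
  by apply: functional_extensionality_dep => y; apply: funext.
have ggood j : good j (fun k _ => g k) (g j).
  rewrite gE /step; case: pselect => [e|ne]; first by case: (cid e).
  exfalso; apply: ne.
  have [x xP] : exists x, forall k, strict Q k j -> lt (g k) x.
    apply: contrapT => nx; apply: (ncof _ (svalP j)).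
    (* If g were cofinal below j, then so would be a map defined below j < i. *)
    pose h (k : P) := if pselect (strict (succ_le W) (Some k) i) is left p
      then g (exist _ k p) else f k.
    have hE (k : mu) : h (sval k) = g k.
      rewrite /h; case: pselect => [p|[]]; last exact: svalP k.
      by congr g; exact: mu_eq.
    exists h => x; apply: contrapT => nk; apply: nx; exists x => k kj.
    have [//|gx|xg] := lt_tri (g k) x; exfalso; apply: nk; exists (sval k);
      by split; [exact/QW | rewrite hE; first [by left | by right]].
  have [xf|xf|fx] := lt_tri x (f (sval j)).
  - by exists (f (sval j)); split; [left | move=> k /xP/lt_trans; apply].
  - by exists (f (sval j)); split; [left | rewrite -xf].
  - by exists x; split; [right | exact: xP].
exists g; split.
- split=> // j muj; have /card_leRP[G [Gt Gi]] := muj.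
  apply: (ncof _ (svalP j)).
  have /choice[h hP] : forall k, exists y, forall k' l : mu,
      sval k' = k -> G l k' -> y = f (sval l).
    move=> k; have [[k' [l [kk' Glk]]]|nk] :=
        pselect (exists k' l : mu, sval k' = k /\ G l k').
      exists (f (sval l)) => k2 l2 kk2 Gl2.
      by rewrite (Gi l l2 k') // (mu_eq k' k2) // kk' kk2.
    by exists (f k) => k' l kk' Gl; case: nk; exists k', l.
  exists h => x; have [k [ki xfk]] := fcof x.
  have [//|k' k'j Gk] := Gt (exist _ k ki).
  exists (sval k'); split; first exact/QW.
  by rewrite (hP _ k' (exist _ k ki)).
- by move=> k j kj; have [_] := ggood j; apply.
- move=> x; have [k [ki xfk]] := fcof x; exists (exist _ k ki).
  have [/= fg _] := ggood (exist _ k ki).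
  case: xfk => [->//|xf]; case: fg => [<-|fg]; right=> //.
  exact: lt_trans xf fg.
Qed.

End Cofinal.

(** * Bounds for the parts of a model *)

Section Bounds.
Variables (alpha : countable_ordinal) (M : Type) (J : interp alpha M).
Hypothesis H : psi_holds J.

Let wi := @ord_wo (idx alpha).
Let L b : set M := [set x | iL J b x].
Let lt := ilt J (pos_top alpha).
Let A := aleph alpha.
Let Theta := aleph (ord_succ alpha).

Lemma model_inf : nat <=c M.
Proof.
apply: (inj_le (f := ic J)) => m n e; apply: contrapT => /eqP mn.
pose p : {p : nat * nat | p.1 != p.2} := exist (fun p => is_true (p.1 != p.2)) (m, n) mn.
exact: (@psi_c_inj _ _ _ H p e).
Qed.

(** Induction on [b]; at successors the surjections bound the segments of [L_b],
    so that [card_le_of_segments] applies. *)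
Lemma size_L (b : idx alpha) : b <> idx_top alpha -> L b #<= [set: aleph_at b].
Proof.
elim/(wo_ind wi): b => b IH bt.
have binf := aleph_at_inf b.
have [->|b0] := pselect (b = idx0 alpha).
  apply: card_le_trans (aleph_at_inf _).
  apply/card_leRP; exists (fun x n => x = ic J n); split=> [x Lx|x y n _ _ -> //].
  by have [/(_ Lx)[n ->] _] := psi_L0 H x; exists n.
have b0' : ord_lt (idx0 alpha) b by split; [move=> e; apply: b0 | exact: idx0_le].
have [[c cb]|ns] := pselect (exists c, idx_succ c b); last first.
  have blim : idx_limit b by split=> //; exists (idx0 alpha).
  have -> : L b = \bigcup_(j in [set j | ord_lt j b]) L j.
    apply/seteqP; split=> x.
      move=> Lx; have [/(_ Lx)[[j jb] /= Lj] _] := psi_L_limit H (exist _ b (asboolT blim)) x.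
      by exists j => //; exact: asboolW jb.
    move=> [j jb Lj]; have [_ h] := psi_L_limit H (exist _ b (asboolT blim)) x.
    by apply: h; exists (exist _ j (asboolT jb)).
  apply: card_bigcup_le => //; first exact: card_le_trans (countableP _) binf.
  move=> j jb; apply: (@card_le_trans _ _ _ [set: aleph_at j]).
    apply: IH => // jt; move: jb; rewrite jt => tb; apply: bt.
    by case: (b) tb => [?|] [].
  by apply: aleph_at_mono; case: jb.
have [clt cmin] := cb.
have [i ci] : exists i, c = Some (Some i).
  case: (c) clt cmin => [[i|]|] clt cmin; first by exists i.
    case: bt; case: (b) clt => [[j|]|] // [ne /= le]; [by [] | by case: ne].
  by case: (b) clt => [?|] [].
have bpos : `[< exists c : idx alpha, ord_lt c b >] by apply/asboolP; exists c.
pose bp : idx_pos alpha := exist _ b bpos.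
have cb' : `[< idx_succ (Some (Some i)) (val bp) >] by apply/asboolP; rewrite -ci.
have bpt : val bp != idx_top alpha by apply/eqP.
have [_ [_ ltri]] := psi_L_linear H (exist (fun i => is_true (val i != idx_top alpha)) bp bpt).
apply: (card_le_of_segments (lt := ilt J bp)) => //.
  move=> x y Lx Ly; have [|[]] := ltri x y (conj Lx Ly).
  + by constructor 1.
  + by constructor 2.
  + by constructor 3.
move=> x Lx bx; apply: (aleph_at_lt clt); apply: (card_le_trans bx).
pose j : {j : idx_pos alpha | `[< idx_succ (Some (Some i)) (val j) >]} :=
  exist (fun j : idx_pos alpha => is_true `[< idx_succ (Some (Some i)) (val j) >]) bp cb'.
have /surj_graph_le h := @psi_F_surj _ _ _ H i j x Lx.
apply: (@card_le_trans _ _ _ _ _ _ _ (IH c clt _)); last first.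
  by move=> ct; move: ci; rewrite ct.
rewrite ci; apply: card_le_trans h; apply: subset_card_le => y [Ly [->|yx]].
  by split=> //; right.
by split=> //; left.
Qed.

Definition nonmax : set M := [set x | iL J (idx_top alpha) x /\ ~ is_maximum J x].

Lemma top_lt_irr x : iL J (idx_top alpha) x -> ~ lt x x.
Proof. by have [h _] := psi_top_linear H; apply: h. Qed.

Lemma top_lt_trichotomy x y : iL J (idx_top alpha) x -> iL J (idx_top alpha) y ->
  [\/ lt x y, x = y | lt y x].
Proof.
move=> Lx Ly; have [_ [_ h]] := psi_top_linear H; have [|[]] := h x y (conj Lx Ly).
- by constructor 1.
- by constructor 2.
- by constructor 3.
Qed.

Lemma top_lt_trans x y z : iL J (idx_top alpha) x -> iL J (idx_top alpha) y ->
  iL J (idx_top alpha) z -> lt x y -> lt y z -> lt x z.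
Proof. by move=> Lx Ly Lz xy yz; have [_ [h _]] := psi_top_linear H; apply: (h x y z). Qed.

Lemma size_L_alpha : L (idx_alpha alpha) #<= [set: A].
Proof.
apply: (@card_le_trans _ _ _ [set: aleph_at (idx_alpha alpha)]).
  exact: size_L.
by have := aleph_at_alpha alpha; rewrite card_eq_le => /andP[].
Qed.

Lemma not_aleph_succ_le : ~ (Theta <=c A).
Proof.
move=> TA; apply: (@not_succ_card_le A); apply: card_le_trans TA.
by have := aleph_succ alpha; rewrite card_eq_le => /andP[].
Qed.

(** The maximum is left out because nothing bounds the segment that ends
    there. *)
Lemma size_nonmax : nonmax #<= [set: Theta].
Proof.
apply: (card_le_of_segments (lt := lt)); first exact: aleph_inf.
  by move=> x y [Lx _] [Ly _]; exact: top_lt_trichotomy.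
move=> x xP Tx; apply: not_aleph_succ_le; apply: (card_le_trans Tx).
have [/surj_graph_le h _] := psi_top_surj H xP; apply: card_le_trans size_L_alpha.
apply: card_le_trans h; apply: subset_card_le => y [[Ly _] [->|yx]].
  by split; [case: xP | right].
by split=> //; left.
Qed.

Lemma size_level x : nonmax x -> [set v | iV J x v] #<= [set: A].
Proof.
move=> xP; have [_ /surj_graph_le h] := psi_top_surj H xP.
exact: card_le_trans h size_L_alpha.
Qed.

Definition branches : set M := [set v | exists2 a, is_maximum J a & iV J a v].

Lemma maximum_uniq a b : is_maximum J a -> is_maximum J b -> a = b.
Proof.
move=> [La amax] [Lb bmax]; have [ba|//] := amax b Lb.
have [ab|//] := bmax a La; exfalso.
exact: top_lt_irr La (top_lt_trans La Lb La ab ba).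
Qed.

(** All elements outside the last level are accounted for by sets of size at
    most aleph_(alpha + 1). *)
Lemma size_model : M <=c Theta \/ ~ (branches #<= [set: Theta]) /\ [set: M] #<= branches.
Proof.
have Tinf : nat <=c Theta := aleph_inf _.
pose rest : set M := (\bigcup_(b in [set b | b <> idx_top alpha]) L b) `|`
  (nonmax `|` (is_maximum J `|` \bigcup_(x in nonmax) [set v | iV J x v])).
have restT : rest #<= [set: Theta].
  apply: card_setU_le => //.
    apply: card_bigcup_le => //; first exact: card_le_trans (countableP _) Tinf.
    move=> b bt; apply: card_le_trans (size_L bt) _.
    have bA : aleph_at b <=c aleph_at (idx_alpha alpha).
      by apply: aleph_at_mono; case: b bt => [[i|]|] //= _; exact: wo_refl.
    apply: (card_le_trans bA); apply: card_le_trans (aleph_le_succ alpha).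
    by have := aleph_at_alpha alpha; rewrite card_eq_le => /andP[].
  apply: card_setU_le => //; first exact: size_nonmax.
  apply: card_setU_le => //.
    have [[a aP]|na] := pselect (exists a, is_maximum J a).
      apply: card_le_trans (card_set1_le a (infinite_nonempty Tinf)).
      by apply: subset_card_le => b bP; exact: maximum_uniq.
    apply: (@card_le_trans _ _ _ (@set0 M)); last exact: card_ge0.
    by apply: subset_card_le => b bP; case: na; exists b.
  apply: card_bigcup_le => //; first exact: size_nonmax.
  move=> x /size_level xP; exact: card_le_trans xP (aleph_le_succ alpha).
have MU : [set: M] = rest `|` branches.
  apply/seteqP; split=> // x _.
  have [[b Lb]|[a [La Vx]]] := psi_cover H x.
    left; have [bt|bt] := pselect (b = idx_top alpha); last by left; exists b.
    rewrite bt in Lb; right.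
    by have [xm|xm] := pselect (is_maximum J x); [right; left | left].
  have [am|am] := pselect (is_maximum J a); first by right; exists a.
  by left; right; right; right; exists a.
have [bT|bT] := pselect (branches #<= [set: Theta]); [left | right; split=> //].
  by rewrite MU; apply: card_setU_le.
have Tb := card_leNge bT; rewrite MU; apply: card_setU_le.
- exact: card_le_trans Tinf Tb.
- exact: card_le_trans restT Tb.
- exact: card_lexx.
Qed.

End Bounds.

(** * Models give Kurepa trees *)

Section Kurepa.
Variables (alpha : countable_ordinal) (M : Type) (J : interp alpha M).
Hypothesis H : psi_holds J.

Let lt := ilt J (pos_top alpha).
Let A := aleph alpha.
Let Theta := aleph (ord_succ alpha).
Let top x := iL J (idx_top alpha) x.
Let T := iT J.
Let V := iV J.

Lemma level_inj a b x : top a -> top b -> V a x -> V b x -> a = b.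
Proof.
move=> La Lb Vax Vbx; apply: contrapT => ab.
by apply: (psi_levels_disjoint H (conj La (conj Lb ab))); exists x.
Qed.

Lemma T_level a b x y : top a -> top b -> V a x -> V b y -> T x y -> lt a b.
Proof.
move=> La Lb Vax Vby /(psi_T_levels H)[a' [b' [La' [Lb' [Va'x [Vb'y ab]]]]]].
by rewrite (level_inj La La' Vax Va'x) (level_inj Lb Lb' Vby Vb'y).
Qed.

Lemma pred_uniq a x y z : top a -> V a x -> V a y -> T x z -> T y z -> x = y.
Proof.
move=> La Vx Vy Tx Ty; have [xy|[//|yx]] := psi_T_chain H (conj Tx Ty).
  by have := T_level La La Vx Vy xy => /(top_lt_irr H La).
by have := T_level La La Vy Vx yx => /(top_lt_irr H La).
Qed.

Lemma nonmax_lt m a : is_maximum J m -> nonmax J a -> lt a m.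
Proof.
move=> [Lm mmax] [La na]; have [//|am] := mmax a La.
by case: na; rewrite am; split.
Qed.

Lemma lt_nonmax a b : top a -> top b -> lt a b -> nonmax J a.
Proof.
move=> La Lb ab; split=> // -[_ amax]; have [ba|ba] := amax b Lb.
  exact: (top_lt_irr H La (top_lt_trans H La Lb La ab ba)).
by move: ab; rewrite ba => /(top_lt_irr H La).
Qed.

Variable m : M.
Hypothesis mmax : is_maximum J m.
Variables (mu : Type) (Q : rel mu) (g : mu -> M).
Hypotheses (muQ : initial_ordinal Q) (gL : forall i, nonmax J (g i))
  (glt : forall i j, strict Q i j -> lt (g i) (g j))
  (gcof : forall x, nonmax J x -> exists i, x = g i \/ lt x (g i)).

Let wQ : well_order Q := muQ.1.
Let Lm : top m := mmax.1.
Let gT i : top (g i) := (gL i).1.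

Lemma pred_ex a x j : top a -> V a x -> lt (g j) a -> exists y, V (g j) y /\ T y x.
Proof.
move=> La Vx ga; exact: (psi_T_down H (conj La (conj (gT j) (conj Vx ga)))).
Qed.

Lemma branch_pred v j : V m v -> exists y, V (g j) y /\ T y v.
Proof. by move=> Vv; apply: pred_ex Lm Vv _; exact: nonmax_lt. Qed.

(** Every level below [m] is at or below some [g i], and the predecessor of [v] at
    [g i] determines the predecessors of [v] at lower levels. *)
Lemma branch_sep v w : V m v -> V m w ->
  (forall i y, V (g i) y -> T y v -> T y w) -> v = w.
Proof.
have sub v' w' : V m v' -> V m w' ->
    (forall i y, V (g i) y -> T y v' -> T y w') -> forall u, T u v' -> T u w'.
  move=> Vv Vw vw u Tuv.
  have [a [b [La [Lb [Va [Vb ab]]]]]] := psi_T_levels H Tuv.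
  have bm := level_inj Lb Lm Vb Vv; rewrite {}bm in ab.
  have [i [ai|ai]] := gcof (lt_nonmax La Lm ab).
    by apply: (vw i) => //; rewrite -ai.
  have [y [Vy Tyv]] := branch_pred i Vv.
  have [u' [Vu' Tu'y]] := psi_T_down H (conj (gT i) (conj La (conj Vy ai))).
  have -> : u = u' by apply: (pred_uniq La Va Vu' Tuv); apply: (psi_T_trans H (conj Tu'y Tyv)).
  by apply: (psi_T_trans H (conj Tu'y _)); apply: (vw i).
move=> Vv Vw vw; apply: contrapT => ne.
apply: (psi_max_sep H mmax (conj Vv (conj Vw ne))) => u; split; first exact: (sub v w).
apply: (sub w v) => // i y Vy Tyw; have [z [Vz Tzv]] := branch_pred i Vv.
by rewrite (pred_uniq (gT i) Vy Vz Tyw (vw i z Vz Tzv)).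
Qed.

(** Each level has at most aleph_alpha nodes, so a branch is coded by a sequence
    of elements of aleph_alpha when there are countably many levels. *)
Lemma branches_le_pow : mu <=c nat -> branches J #<= [set: nat -> A].
Proof.
move=> munat; have [e einj] := card_le_inj munat 0.
(* The level g i is coded at the place e i of the sequence. *)
have /choice[code codeP] : forall i, exists G : M -> A -> Prop,
    (forall x, V (g i) x -> exists y, G x y) /\
    (forall x x' y, V (g i) x -> V (g i) x' -> G x y -> G x' y -> x = x').
  move=> i; have /card_leRP[G [Gt Gi]] := size_level H (gL i).
  by exists G; split=> // x Vx; have [y _] := Gt x Vx; exists y.
apply/card_leRP; exists (fun v h => forall i, exists y,
  [/\ V (g i) y, T y v & code i y (h (e i))]); split.
  move=> v [m' m'max Vv]; rewrite (maximum_uniq H m'max mmax) in Vv.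
  suff /choice[h hP] : forall n, exists a : A, forall i, e i = n -> exists y,
      [/\ V (g i) y, T y v & code i y a].
    by exists h => // i; exact: hP.
  move=> n; have [[i <-]|ni] := pselect (exists i, e i = n); last first.
    have [a0 _] := infinite_nonempty (aleph_inf alpha); exists a0 => i ei.
    by case: ni; exists i.
  have [y [Vy Tyv]] := branch_pred i Vv; have [ct _] := codeP i.
  have [a cya] := ct y Vy; exists a => j /einj ji; exists y.
  by rewrite ji.
move=> v w h [m1 m1max Vv] [m2 m2max Vw] hv hw.
rewrite (maximum_uniq H m1max mmax) in Vv; rewrite (maximum_uniq H m2max mmax) in Vw.
apply: branch_sep => // i y Vy Tyv.
have [y1 [Vy1 Ty1 c1]] := hv i; have [y2 [Vy2 Ty2 c2]] := hw i.
have [_ ci] := codeP i.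
by rewrite (pred_uniq (gT i) Vy Vy1 Tyv Ty1) (ci _ _ _ Vy1 Vy2 c1 c2).
Qed.

Let X := {p : mu * M | V (g p.1) p.2}.
Let lv (p : X) : mu := (sval p).1.
Let nd (p : X) : M := (sval p).2.
Let R : rel X := fun p q => `[< p = q \/ T (nd p) (nd q) >].

Let lvV (p : X) : V (g (lv p)) (nd p) := svalP p.

Let X_eq (p q : X) : lv p = lv q -> nd p = nd q -> p = q.
Proof.
rewrite /lv /nd => pq1 pq2; apply: eq_sig_hprop.
  by move=> x u v; exact: Prop_irrelevance.
by case: (sval p) (sval q) pq1 pq2 => [? ?] [? ?] /= -> ->.
Qed.

Let T_lv (p q : X) : T (nd p) (nd q) -> strict Q (lv p) (lv q).
Proof.
move=> /(T_level (gT _) (gT _) (lvV p) (lvV q)) pq.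
have [//|e|/glt qp] := wo_trichotomy wQ (lv p) (lv q); exfalso.
  by move: pq; rewrite e => /(top_lt_irr H (gT _)).
exact: (top_lt_irr H (gT _) (top_lt_trans H (gT _) (gT _) (gT _) pq qp)).
Qed.

Let strictR (p q : X) : strict R p q <-> T (nd p) (nd q).
Proof.
split=> [[pq /asboolP[]//]|Tpq]; split; last by apply/asboolP; right.
by move=> pq; case: (T_lv Tpq); rewrite pq.
Qed.

Let below_comp (p q : X) z : T (nd p) z -> T (nd q) z ->
  [\/ T (nd p) (nd q), p = q | T (nd q) (nd p)].
Proof.
move=> pz qz; have [pq|[pq|qp]] := psi_T_chain H (conj pz qz).
- by constructor 1.
- constructor 2; apply: X_eq => //.
  have Vq := lvV q; rewrite -pq in Vq.
  have e := level_inj (gT _) (gT _) (lvV p) Vq.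
  have [/glt|//|/glt] := wo_trichotomy wQ (lv p) (lv q);
    by rewrite e => /(top_lt_irr H (gT _)).
- by constructor 3.
Qed.

Let R_lv (p q : X) z : T (nd p) z -> T (nd q) z -> R p q = Q (lv p) (lv q).
Proof.
move=> pz qz; apply/asboolP/idP => [[->|/T_lv[]//]|pq]; first exact: wo_refl.
have [|->|/T_lv qp] := below_comp pz qz; [by right | by left |].
by move: qp => /(wo_ltNge wQ).
Qed.

Let lv_inj (p q : X) z : T (nd p) z -> T (nd q) z -> lv p = lv q -> p = q.
Proof.
move=> pz qz pq; have [/T_lv[]//|//|/T_lv[]] := below_comp pz qz.
by rewrite pq.
Qed.

(** Used with [z] a node, for the height, and with [z] in the last level, for the
    length of the branches. *)
Let below_iso z (D : set mu) :
  (forall p : X, T (nd p) z -> D (lv p)) ->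
  (forall j, D j -> exists y, V (g j) y /\ T y z) ->
  order_iso R Q [set p | T (nd p) z] D.
Proof.
move=> zD Dz; exists lv; last by move=> p q pz qz; exact: R_lv pz qz.
split=> [p /zD//|p q|j /Dz[y [Vy Tyz]]].
  by rewrite !inE; exact: lv_inj.
by exists (exist (fun p => V (g p.1) p.2) (j, y) Vy).
Qed.

Let belowE (q : X) : below R q = [set p | T (nd p) (nd q)].
Proof. by apply/seteqP; split=> p /strictR. Qed.

Let node_iso (q : X) : order_iso R Q (below R q) (below Q (lv q)).
Proof.
rewrite belowE; apply: below_iso => [p /T_lv//|j jq].
by apply: pred_ex (gT (lv q)) (lvV q) _; exact: glt.
Qed.

(** By [iso_below_le], the order type of the predecessors of a node recovers its
    level. *)
Let tree_levelE i q : tree_level R Q i q <-> lv q = i.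
Proof.
split=> [qi|<-]; last exact: node_iso.
by apply: (wo_anti wQ); [exact: iso_below_le (node_iso q) qi |
  exact: iso_below_le qi (node_iso q)].
Qed.

Let is_treeR : is_tree R.
Proof.
split; first split; first split.
- by move=> p; apply/asboolP; left.
- move=> q p r /asboolP[->//|pq] /asboolP[<-|qr]; apply/asboolP; first by right.
  by right; exact: (psi_T_trans H (conj pq qr)).
- move=> p q /andP[/asboolP[//|pq] /asboolP[->//|qp]].
  have /(wo_ltNge wQ)[] := T_lv pq; by have [] := T_lv qp.
move=> x B sB [p0 Bp0].
have Bx p : p \in B -> T (nd p) (nd x).
  by move=> Bp; apply/strictR; have := sB p Bp => /set_mem.
have [|_ [[p Bp <-] pmin]] := wo_min wQ (P := [set lv p | p in [set p | p \in B]]).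
  by exists (lv p0), p0.
exists p; split.
  split=> // q Bq; rewrite (R_lv (Bx p Bp) (Bx q Bq)); apply: pmin; exists q => //.
move=> q [Bq qmin]; apply: (lv_inj (Bx p Bp) (Bx q Bq)).
apply: (wo_anti wQ); first by apply: pmin; exists q.
by rewrite -(R_lv (Bx q Bq) (Bx p Bp)); exact: qmin.
Qed.

(** The predecessors of an element of the last level form a branch of type [mu],
    which is maximal since it meets every level. *)
Lemma model_kurepa (kappa : Type) : [set: kappa] #<= branches J ->
  mu <=c Theta -> Theta <=c kappa -> ~ (kappa <=c Theta) ->
  kurepa_tree mu Theta kappa R.
Proof.
move=> kb muT Tk nkT.
have [k0 _] := infinite_nonempty (card_le_trans (aleph_inf _) Tk).
split=> //.
  by split; [exact: card_le_trans muT Tk | move=> kmu; apply: nkT; exact: card_le_trans kmu muT].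
have brV v : branches J v -> V m v.
  by move=> [m' m'max Vv]; rewrite (maximum_uniq H m'max mmax) in Vv.
exists Q; split=> //.
- split=> [q|i]; first by exists (lv q); apply/tree_levelE.
  have /card_leRP[G [/(_ k0 Logic.I)[v /brV Vv _] _]] := kb.
  have [y [Vy _]] := branch_pred i Vv.
  by exists (exist (fun p => V (g p.1) p.2) (i, y) Vy); apply/tree_levelE.
- move=> i.
  have liA : tree_level R Q i #<= [set: A].
    apply: card_le_trans (size_level H (gL i)).
    apply/card_leRP; exists (fun p y => y = nd p); split.
      by move=> p /tree_levelE <-; exists (nd p) => //; exact: lvV.
    by move=> p q y /tree_levelE pi /tree_levelE qi -> pq; apply: X_eq; rewrite ?pi.
  split; first exact: card_le_trans liA (aleph_le_succ alpha).
  by move=> Tl; apply: (@not_aleph_succ_le alpha); exact: card_le_trans Tl liA.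
apply: (card_le_trans kb); apply/card_leRP.
exists (fun v B => B = [set p | T (nd p) v]); split.
  move=> v /brV Vv; exists [set p | T (nd p) v] => //.
  have biso : order_iso R Q [set p | T (nd p) v] [set: mu].
    by apply: below_iso => // j _; exact: branch_pred.
  split=> //; split.
    move=> p q /set_mem pv /set_mem qv; rewrite !(R_lv pv qv) !(R_lv qv pv).
    by apply/orP; exact: wo_total.
  move=> C Cch BC; apply/seteqP; split=> // q Cq.
  have [y [Vy Tyv]] := branch_pred (lv q) Vv.
  pose p : X := exist (fun p => V (g p.1) p.2) (lv q, y) Vy.
  have Cp : C p by apply: BC.
  have /orP[/asboolP[<-//|pq]|/asboolP[->//|qp]] := Cch p q (mem_set Cp) (mem_set Cq).
    by have [] := T_lv pq.
  by have [] := T_lv qp.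
move=> v w B /brV Vv /brV Vw -> vw; apply: branch_sep => // i y Vy Tyv.
pose p : X := exist (fun p => V (g p.1) p.2) (i, y) Vy.
have : [set p | T (nd p) v] p by [].
by rewrite vw.
Qed.

End Kurepa.

(** If more than aleph_(alpha + 1) elements exist, all but that many are branches. The
    cofinality [mu] of the set of levels decides between countable sequences of
    nodes and a Kurepa tree. *)
Lemma spec_trichotomy alpha kappa : spec (psi alpha) kappa ->
  nat <=c kappa /\
  [\/ kappa <=c (nat -> aleph alpha),
      [set: kappa] #= [set: aleph (ord_succ alpha)] |
      exists (mu X : Type) (R : rel X),
        [/\ aleph1 <=c mu, mu <=c aleph (ord_succ alpha) &
            kurepa_tree mu (aleph (ord_succ alpha)) kappa R]].
Proof.
set A := aleph alpha; set Theta := aleph (ord_succ alpha).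
move=> [M0 M0psi M0k]; have [J JM] := interp_structureP M0.
rewrite -{}JM in M0psi; have H := (models_psi J).1 M0psi.
have /card_eqPle[Mk kM] : [set: dom M0] #= [set: kappa] by [].
have kinf := card_le_trans (model_inf H) Mk.
split=> //; have [MT|[bT Mb]] := size_model H.
  have [Tk|/lt_aleph_succ kA] := pselect (Theta <=c kappa).
    by constructor 2; apply/card_eqPle; split=> //; exact: card_le_trans kM MT.
  constructor 1; apply: (card_le_trans kA).
  by apply: (inj_le (f := fun a (_ : nat) => a)) => a b /(congr1 (fun f => f 0)).
have [m mmax] : exists m, is_maximum J m.
  apply: contrapT => nm; apply: bT; apply: (@card_le_trans _ _ _ (@set0 M0)).
    by apply: subset_card_le => v [a amax _]; case: nm; exists a.
  exact: card_ge0.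
pose lt (x y : {x | nonmax J x}) := ilt J (pos_top alpha) (sval x) (sval y).
have val_eq (x y : {x | nonmax J x}) : sval x = sval y -> x = y.
  by move=> xy; apply: eq_sig_hprop => // u p q; exact: Prop_irrelevance.
have [x y z xy yz|x y|mu [Q [g [muQ glt gcof]]]] := @cofinal_seq _ lt.
- exact: (top_lt_trans H (svalP x).1 (svalP y).1 (svalP z).1 xy yz).
- have [xy|/val_eq xy|yx] := top_lt_trichotomy H (svalP x).1 (svalP y).1.
  + by constructor 1.
  + by constructor 2.
  + by constructor 3.
have irr x : ~ lt x x by exact: (top_lt_irr H (svalP x).1).
have ginj : injective g.
  move=> i j gij; have [/glt|//|/glt] := wo_trichotomy muQ.1 i j;
    by rewrite gij => /irr.
pose g' i := sval (g i).
have gcof' x : nonmax J x -> exists i, x = g' i \/ ilt J (pos_top alpha) x (g' i).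
  move=> xP; have [i [xi|xi]] := gcof (exist _ x xP); exists i; last by right.
  by left; rewrite /g' -xi.
have muT : mu <=c Theta.
  apply: card_le_trans (size_nonmax H); apply: (inj_le_set (f := g')).
    by move=> i j /val_eq/ginj.
  by move=> i; exact: svalP (g i).
have [munat|munat] := pselect (mu <=c nat).
  constructor 1; apply: (card_le_trans kM); apply: (card_le_trans Mb).
  by apply: (branches_le_pow H mmax (g := g')) => // i; exact: svalP (g i).
have kb : [set: kappa] #<= branches J := card_le_trans kM Mb.
have Tk : Theta <=c kappa.
  apply: card_le_trans Mk; apply: card_leNge => MT; apply: bT.
  by apply: card_le_trans MT; exact: card_leT.
have nkT : ~ (kappa <=c Theta).
  move=> kT; apply: bT; apply: card_le_trans kT; apply: card_le_trans Mk.
  exact: card_leT.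
have g'L i : nonmax J (g' i) := svalP (g i).
have kt := model_kurepa H mmax muQ g'L glt gcof' kb muT Tk nkT.
constructor 3; exists mu; do 2 eexists; split; [| |exact: kt] => //.
by apply: contrapT => /(lt_succ_card (card_lexx _)).
Qed.

Theorem theorem5p1 (alpha : countable_ordinal) :
  [/\ (* (1) *)
      (forall kappa : Type,
         nat <=c kappa -> kappa <=c (nat -> aleph alpha) ->
         spec (psi alpha) kappa) /\
      spec (psi alpha) (aleph (ord_succ alpha)),
      (* (2) *)
      forall (mu lambda kappa X : Type) (R : rel X),
        aleph1 <=c mu -> mu <=c lambda -> lambda <=c aleph (ord_succ alpha) ->
        kurepa_tree mu lambda kappa R ->
        forall kappa' : Type,
          nat <=c kappa' -> kappa' <=c kappa -> spec (psi alpha) kappa',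
      (* (3) *)
      forall kappa : Type, spec (psi alpha) kappa ->
        [\/ nat <=c kappa /\ kappa <=c (nat -> aleph alpha),
            [set: kappa] #= [set: aleph (ord_succ alpha)] |
            exists (mu lambda kappa' X : Type) (R : rel X),
              [/\ aleph1 <=c mu, mu <=c lambda,
                  lambda <=c aleph (ord_succ alpha),
                  kurepa_tree mu lambda kappa' R &
                  nat <=c kappa /\ kappa <=c kappa']]
      (* (3), second formulation *)
    & forall kappa : Type, spec (psi alpha) kappa ->
        (nat <=c kappa /\
         (kappa <=c (nat -> aleph alpha) \/
          kappa <=c aleph (ord_succ alpha))) \/
        exists (mu lambda X : Type) (R : rel X),
          [/\ mu <=c lambda, lambda <=c aleph (ord_succ alpha) &
              kurepa_tree mu lambda kappa R]].
Proof.
split.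
- split=> [kappa kinf kpow|]; last exact: spec_aleph_succ.
  have [kA|Ak] := card_le_total [set: kappa] [set: aleph alpha].
    exact: spec_le_aleph.
  exact: spec_pow.
- move=> mu lambda kappa X R mu1 _ lT kt kappa' k'inf k'k.
  apply: (spec_kurepa _ lT kt k'inf k'k).
  exact: card_le_trans (succ_card_inf (card_lexx _)) mu1.
- move=> kappa /spec_trichotomy[kinf []].
  + by constructor 1.
  + by constructor 2.
  + move=> [mu [X [R [mu1 muT kt]]]]; constructor 3.
    exists mu, (aleph (ord_succ alpha)), kappa, X, R.
    by split=> //; split=> //; exact: card_lexx.
- move=> kappa /spec_trichotomy[kinf []].
  + by left; split=> //; left.
  + by move=> /card_eqPle[kT _]; left; split=> //; right.
  + move=> [mu [X [R [mu1 muT kt]]]]; right.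
    exists mu, (aleph (ord_succ alpha)), X, R.
    by split=> //; exact: card_lexx.
Qed.
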